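(* Consider the time-homogeneous infinite-horizon leader-follower problem described in the context with $\beta\in(0,1]$: minimize $J_\infty$ over all strategies of the form $u^0_t=g^0_t(x^0_t,\bar x_t)$ and $u^i_t=g^i_t(x^i_t,\bar x_t,x^0_t)$, $i\in\{1,\dots,n\}$, $t\in\mathbb{N}$. Suppose that the initial states and noise processes are mutually independent in time; that $Q+P+H$ and $\bar Q$ are positive semi-definite and $R^0$ and $R$ are positive definite; and that $(\sqrt\beta A,\sqrt\beta B)$ and $(\sqrt\beta\bar A,\sqrt\beta\bar B)$ are stabilizable and $(\sqrt\beta A,Q^{1/2})$ and $(\sqrt\beta\bar A,\bar Q^{1/2})$ are detectable. Then the optimal strategy is given, for $t\in\mathbb{N}$ and $i\in\{1,\dots,n\}$, by $$u^0_t=\bar L^{1,1}x^0_t+\bar L^{1,2}\bar x_t,\qquad u^i_t=\breve Lx^i_t+\bar L^{2,1}x^0_t+(\bar L^{2,2}-\breve L)\bar x_t,$$ where $$\breve L=-\left(B^\intercal\breve MB+\beta^{-1}R\right)^{-1}B^\intercal\breve MA,$$ $$\bar L=\begin{bmatrix}\bar L^{1,1}&\bar L^{1,2}\\\bar L^{2,1}&\bar L^{2,2}\end{bmatrix}=-\left(\bar B^\intercal\bar M\bar B+\beta^{-1}\bar R\right)^{-1}\bar B^\intercal\bar M\bar A,$$ each block $\bar L^{k,l}$ is $d_u\times d_x$, and $\breve M,\bar M$ are obtained by solving the algebraic Riccati equations $$\breve M=-\beta A^\intercal\breve MB\left(B^\intercal\breve MB+\beta^{-1}R\right)^{-1}B^\intercal\breve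 MA+\beta A^\intercal\breve MA+Q+P+H,$$ $$\bar M=-\beta\bar A^\intercal\bar M\bar B\left(\bar B^\intercal\bar M\bar B+\beta^{-1}\bar R\right)^{-1}\bar B^\intercal\bar M\bar A+\beta\bar A^\intercal\bar M\bar A+\bar Q.$$
   Context: Let $n,d_x,d_u\in\mathbb{N}$. There is one leader (index $0$) and $n$ followers (indices $1,\dots,n$). At time $t\in\mathbb{N}=\{1,2,\dots\}$, agent $i\in\{0,1,\dots,n\}$ has state $x^i_t\in\mathbb{R}^{d_x}$, action $u^i_t\in\mathbb{R}^{d_u}$ and random state noise $w^i_t\in\mathbb{R}^{d_x}$. The mean-field is $\bar x_t=\frac1n\sum_{i=1}^nx^i_t$. The dynamics are time-homogeneous: $$x^0_{t+1}=A^0x^0_t+B^0u^0_t+D^0\bar x_t+w^0_t,$$ $$x^i_{t+1}=Ax^i_t+Bu^i_t+D\bar x_t+Ex^0_t+w^i_t,\quad i\in\{1,\dots,n\},$$ where all coefficient matrices are deterministic, real and of compatible dimensions. Information structure: $u^0_t=g^0_t(x^0_t,\bar x_t)$ with $g^0_t:(\mathbb{R}^{d_x})^2\to\mathbb{R}^{d_u}$, and $u^i_t=g^i_t(x^i_t,\bar x_t,x^0_t)$ with $g^i_t:(\mathbb{R}^{d_x})^3\to\mathbb{R}^{d_u}$ for $i\in\{1,\dots,n\}$. A strategy is the collection of all these functions; it is optimal if it minimizes $J_\infty$ among all such strategies. Cost, with $\beta\in(0,1]$ (discounted if $\beta<1$, undiscounted if $\beta=1$): $$J_\infty=\mathbb{E}\Big[\sum_{t=1}^\infty\beta^{t-1}\Big((x^0_t)^\intercal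 Q^0x^0_t+(u^0_t)^\intercal R^0u^0_t+\frac1n\sum_{i=1}^n\big((x^i_t)^\intercal Qx^i_t+(x^i_t-x^0_t)^\intercal P(x^i_t-x^0_t)+(u^i_t)^\intercal Ru^i_t\big)+\frac1{2n^2}\sum_{i=1}^n\sum_{j=1}^n(x^i_t-x^j_t)^\intercal H(x^i_t-x^j_t)\Big)\Big],$$ where $Q^0,R^0,Q,P,R,H$ are symmetric. ''Mutually independent in time'' means that the random vectors $(x^0_1,\dots,x^n_1)$, $(w^0_1,\dots,w^n_1)$, $(w^0_2,\dots,w^n_2),\dots$ are mutually independent; the distributions need not be Gaussian. Define $$\bar A=\begin{bmatrix}A^0&D^0\\ E&A+D\end{bmatrix},\ \bar B=\begin{bmatrix}B^0&0\\0&B\end{bmatrix},\ \bar Q=\begin{bmatrix}Q^0+P&-P\\-P&Q+P\end{bmatrix},\ \bar R=\begin{bmatrix}R^0&0\\0&R\end{bmatrix}.$$ Here $Q^{1/2}$ and $\bar Q^{1/2}$ denote matrix square roots of $Q$ and $\bar Q$. Stabilizability and detectability are in the discrete-time sense.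
   Formalization: The noises are assumed integrable with zero mean (the claim fails e.g. for constant nonzero noise); M-breve is taken to be the least positive semi-definite solution of its Riccati equation (others can be non-optimal), and M-bar any positive semi-definite solution. *)

(* Defs.v *)
(* MathComp / MathComp-Analysis. *)
From HB Require Import structures.
From mathcomp Require Import all_boot all_order all_algebra.
From mathcomp Require Import spectral.
From mathcomp.real_closed Require Import complex.
From mathcomp Require Import all_classical all_reals all_analysis.

Set Implicit Arguments.
Unset Strict Implicit.
Unset Printing Implicit Defensive.

Import Order.TTheory GRing.Theory Num.Theory.
Import numFieldNormedType.Exports.

Local Open Scope classical_set_scope.
Local Open Scope ring_scope.

(* The product (equivalently Borel) sigma-algebra on real matrices, generated
   by the coordinate maps. *)
Definition matrix_display : measure_display.
Proof. exact: default_measure_display. Qed.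

Section measurable_matrix.
Context (R : realType) (m n : nat).

Definition matrix_cylinder : set (set 'M[R]_(m, n)) :=
  [set A | exists i j (B : set R), measurable B /\ A = [set M : 'M[R]_(m, n) | B (M i j)]].

Let matrix_set0 : <<s matrix_cylinder >> set0.
Proof. exact: sigma_algebra0. Qed.

Let matrix_setC A : <<s matrix_cylinder >> A -> <<s matrix_cylinder >> (~` A).
Proof. exact: sigma_algebraC. Qed.

Let matrix_bigcup (F : (set 'M[R]_(m, n))^nat) :
  (forall i, <<s matrix_cylinder >> (F i)) ->
  <<s matrix_cylinder >> (\bigcup_i F i).
Proof. exact: sigma_algebra_bigcup. Qed.

HB.instance Definition _ :=
  @isMeasurable.Build matrix_display 'M[R]_(m, n) <<s matrix_cylinder >>
    matrix_set0 matrix_setC matrix_bigcup.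

End measurable_matrix.

Section linear_systems.
Context (R : realType).

Definition qform d (M : 'M[R]_d) (x : 'cV[R]_d) : R := (x^T *m M *m x) 0 0.

Definition psd d (M : 'M[R]_d) : Prop :=
  M^T = M /\ forall x, 0 <= qform M x.

Definition pd d (M : 'M[R]_d) : Prop :=
  M^T = M /\ forall x, x != 0 -> 0 < qform M x.

Definition cmx m n (M : 'M[R]_(m, n)) : 'M[R[i]]_(m, n) :=
  map_mx (real_complex R) M.

(* All (complex) eigenvalues lie in the open unit disk. *)
Definition schur_stable d (A : 'M[R[i]]_d) : Prop :=
  forall z : R[i], eigenvalue A z -> `|z| < 1.

Definition stabilizable d k (A : 'M[R]_d) (B : 'M[R]_(d, k)) : Prop :=
  exists K : 'M[R]_(k, d), schur_stable (cmx (A + B *m K)).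

(* The output matrix is complex because it is going to be a square root of a
   real symmetric matrix that may have negative eigenvalues. *)
Definition detectable d k (A : 'M[R]_d) (C : 'M[R[i]]_(k, d)) : Prop :=
  exists K : 'M[R[i]]_(d, k), schur_stable (cmx A + K *m C).

(* Principal square root of a real symmetric matrix M: if M = U^-1 diag(l) U
   with U unitary (such U, l are provided by spectralmx and spectral_diag), it
   is U^-1 diag(sqrt l) U.  It is the usual positive semi-definite square root
   when M is positive semi-definite, and complex otherwise. *)
Definition sqrtmx d (M : 'M[R]_d) : 'M[R[i]]_d :=
  let U := spectralmx (cmx M) in
  invmx U *m diag_mx (map_mx sqrtC (spectral_diag (cmx M))) *m U.

Definition riccati_gain d k (beta : R) (A : 'M[R]_d) (B : 'M[R]_(d, k))
    (W : 'M[R]_k) (M : 'M[R]_d) : 'M[R]_(k, d) :=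
  - (invmx (B^T *m M *m B + beta^-1 *: W) *m B^T *m M *m A).

Definition riccati d k (beta : R) (A : 'M[R]_d) (B : 'M[R]_(d, k))
    (V : 'M[R]_d) (W : 'M[R]_k) (M : 'M[R]_d) : Prop :=
  M = - (beta *: (A^T *m M *m B *m invmx (B^T *m M *m B + beta^-1 *: W)
                    *m B^T *m M *m A))
      + beta *: (A^T *m M *m A) + V.

Definition psd_riccati d k (beta : R) (A : 'M[R]_d) (B : 'M[R]_(d, k))
    (V : 'M[R]_d) (W : 'M[R]_k) (M : 'M[R]_d) : Prop :=
  psd M /\ riccati beta A B V W M.

(* Least positive semi-definite solution, in the Loewner order: the quadratic
   form of the optimal cost.  If (sqrt beta A, V^(1/2)) is detectable it is the
   only positive semi-definite solution; otherwise there can be others, whose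
   gains are not optimal. *)
Definition least_psd_riccati d k (beta : R) (A : 'M[R]_d) (B : 'M[R]_(d, k))
    (V : 'M[R]_d) (W : 'M[R]_k) (M : 'M[R]_d) : Prop :=
  psd_riccati beta A B V W M /\
  forall N, psd_riccati beta A B V W N -> psd (N - M).

End linear_systems.

Section leader_follower.
Context (R : realType) (dx du : nat).

Record lf_model := LFModel {
  mA0 : 'M[R]_dx; mB0 : 'M[R]_(dx, du); mD0 : 'M[R]_dx;
  mA : 'M[R]_dx; mB : 'M[R]_(dx, du); mD : 'M[R]_dx; mE : 'M[R]_dx;
  mQ0 : 'M[R]_dx; mR0 : 'M[R]_du;
  mQ : 'M[R]_dx; mP : 'M[R]_dx; mR : 'M[R]_du; mH : 'M[R]_dx }.

Definition Abar (m : lf_model) : 'M[R]_(dx + dx) :=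
  block_mx (mA0 m) (mD0 m) (mE m) (mA m + mD m).
Definition Bbar (m : lf_model) : 'M[R]_(dx + dx, du + du) :=
  block_mx (mB0 m) 0 0 (mB m).
Definition Qbar (m : lf_model) : 'M[R]_(dx + dx) :=
  block_mx (mQ0 m + mP m) (- mP m) (- mP m) (mQ m + mP m).
Definition Rbar (m : lf_model) : 'M[R]_(du + du) :=
  block_mx (mR0 m) 0 0 (mR m).

Context (n : nat).

(* The joint state (or noise) is a matrix whose first column belongs to the
   leader and whose n other columns belong to the followers. *)
Definition leader (S : 'M[R]_(dx, 1 + n)) : 'cV[R]_dx := lsubmx S.
Definition follower (S : 'M[R]_(dx, 1 + n)) (i : 'I_n) : 'cV[R]_dx :=
  col i (rsubmx S).
Definition mean_field (S : 'M[R]_(dx, 1 + n)) : 'cV[R]_dx :=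
  n%:R^-1 *: \sum_(i < n) follower S i.

(* Time is counted from 0: index t stands for the (t+1)-st time instant.
   The arguments of the laws are, in this order, (x^0, mean-field) for the
   leader and (x^i, mean-field, x^0) for follower i. *)
Record strategy := Strategy {
  leader_law : nat -> 'cV[R]_dx -> 'cV[R]_dx -> 'cV[R]_du;
  follower_law : nat -> 'I_n ->
    'cV[R]_dx -> 'cV[R]_dx -> 'cV[R]_dx -> 'cV[R]_du }.

Definition admissible (g : strategy) : Prop :=
  (forall t, measurable_fun [set: 'cV[R]_dx * 'cV[R]_dx]
     (fun z => leader_law g t z.1 z.2)) /\
  (forall t i, measurable_fun [set: 'cV[R]_dx * 'cV[R]_dx * 'cV[R]_dx]
     (fun z => follower_law g t i z.1.1 z.1.2 z.2)).

Definition leader_action (g : strategy) t S : 'cV[R]_du :=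
  leader_law g t (leader S) (mean_field S).
Definition follower_action (g : strategy) t S i : 'cV[R]_du :=
  follower_law g t i (follower S i) (mean_field S) (leader S).

Definition step (m : lf_model) (g : strategy) t (S N : 'M[R]_(dx, 1 + n)) :
    'M[R]_(dx, 1 + n) :=
  row_mx
    (mA0 m *m leader S + mB0 m *m leader_action g t S
       + mD0 m *m mean_field S + leader N)
    (\matrix_(a < dx, i < n)
       (mA m *m follower S i + mB m *m follower_action g t S i
          + mD m *m mean_field S + mE m *m leader S + follower N i) a 0).

Fixpoint state (Omega : Type) (m : lf_model) (g : strategy)
    (X1 : Omega -> 'M[R]_(dx, 1 + n)) (W : nat -> Omega -> 'M[R]_(dx, 1 + n))
    (t : nat) (w : Omega) : 'M[R]_(dx, 1 + n) :=
  if t is s.+1 then step m g s (state m g X1 W s w) (W s w) else X1 w.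

Definition stage_cost (m : lf_model) (g : strategy) t S : R :=
  qform (mQ0 m) (leader S) + qform (mR0 m) (leader_action g t S)
  + n%:R^-1 * \sum_(i < n)
      (qform (mQ m) (follower S i) + qform (mP m) (follower S i - leader S)
       + qform (mR m) (follower_action g t S i))
  + (2 * n%:R ^+ 2)^-1 * \sum_(i < n) \sum_(j < n)
      qform (mH m) (follower S i - follower S j).

(* J_infinity, as an extended real number: an infinite cost is allowed. *)
Definition total_cost d (Omega : measurableType d) (Pr : probability Omega R)
    (beta : R) (m : lf_model) (g : strategy)
    (X1 : Omega -> 'M[R]_(dx, 1 + n)) (W : nat -> Omega -> 'M[R]_(dx, 1 + n))
    : \bar R :=
  (\int[Pr]_w \sum_(0 <= t <oo)
     (beta ^+ t * stage_cost m g t (state m g X1 W t w))%:E)%E.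

Definition optimal d (Omega : measurableType d) (Pr : probability Omega R)
    (beta : R) (m : lf_model)
    (X1 : Omega -> 'M[R]_(dx, 1 + n)) (W : nat -> Omega -> 'M[R]_(dx, 1 + n))
    (g : strategy) : Prop :=
  admissible g /\ forall h, admissible h ->
    (total_cost Pr beta m g X1 W <= total_cost Pr beta m h X1 W)%E.

Definition linear_strategy (Lb : 'M[R]_(du, dx))
    (Lbar : 'M[R]_(du + du, dx + dx)) : strategy :=
  Strategy
    (fun _ x0 xbar => ulsubmx Lbar *m x0 + ursubmx Lbar *m xbar)
    (fun _ _ xi xbar x0 =>
       Lb *m xi + dlsubmx Lbar *m x0 + (drsubmx Lbar - Lb) *m xbar).

End leader_follower.

Section randomness.
Context (R : realType) d (Omega : measurableType d) (Pr : probability Omega R).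

Definition mutually_independent d' (T : measurableType d')
    (X : nat -> Omega -> T) : Prop :=
  forall (s : seq nat) (B : nat -> set T),
    uniq s -> (forall k, measurable (B k)) ->
    Pr (\big[setI/setT]_(k <- s) (X k @^-1` B k)) =
    (\prod_(k <- s) fine (Pr (X k @^-1` B k)))%:E.

(* Only the joint vectors at different times are independent; the entries
   belonging to different agents may be correlated. *)
Definition independent_in_time p q (X1 : Omega -> 'M[R]_(p, q))
    (W : nat -> Omega -> 'M[R]_(p, q)) : Prop :=
  mutually_independent (fun k => if k is t.+1 then W t else X1).

Definition zero_mean p q (N : Omega -> 'M[R]_(p, q)) : Prop :=
  forall a j, Pr.-integrable setT (fun w => (N w a j)%:E) /\
              (\int[Pr]_w (N w a j)%:E = 0)%E.

End randomness.

(* Main.v *)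
(* The deviations x^i - xbar and the aggregate (x^0, xbar) evolve as decoupled
   linear systems, and the stage cost splits accordingly, so that one Bellman
   recursion acts on the joint form
     q(S) = n^-1 sum_i (x^i - xbar)^T M (x^i - xbar) + (x^0, xbar)^T N (x^0, xbar).
   Since the noise at time t is centred and independent of the state,
   E q(y + w) = E q(y) + E q(w), an identity which by Tonelli holds in [0, +oo]
   without any assumption on second moments.
   Completing the square at the Riccati solutions bounds every partial cost of the
   linear strategy by E q(X1) + sum_t beta^(t+1) E q(W_t).  Conversely the cost of
   any strategy dominates the same expression with the value iterates M_k, N_k
   (finite horizon, zero terminal cost) in place of M, N.  The iterates increase
   to M and N, and monotone convergence concludes; no transversality condition on
   the competing strategy is involved.
   The limit of the iterates is finite by stabilizability and is the least positive
   semi-definite solution.  Detectability makes the closed loop of every positive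
   semi-definite solution stable, hence that solution unique. *)
Require Import Defs.
From HB Require Import structures.
From mathcomp Require Import all_boot all_order all_algebra.
From mathcomp.real_closed Require Import complex.
From mathcomp Require Import all_classical all_reals all_analysis.
From mathcomp Require Import measurable_realfun ring lra.

Set Implicit Arguments.
Unset Strict Implicit.
Unset Printing Implicit Defensive.

Import Order.TTheory GRing.Theory Num.Theory.
Import numFieldNormedType.Exports.

Local Open Scope classical_set_scope.
Local Open Scope ring_scope.

(** * Quadratic and bilinear forms; below, M[x] abbreviates [qform M x] *)

Section quadratic_forms.
Context (R : realType).

Definition bform d (M : 'M[R]_d) (x y : 'cV[R]_d) : R := (x^T *m M *m y) 0 0.

Lemma qformE d (M : 'M[R]_d) x : qform M x = bform M x x.
Proof. by []. Qed.

Lemma bformC d (M : 'M[R]_d) x y : M^T = M -> bform M x y = bform M y x.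
Proof.
move=> sM; rewrite /bform.
have -> : (x^T *m M *m y) = (y^T *m M *m x)^T.
  by rewrite !trmx_mul trmxK sM mulmxA.
exact: mxE.
Qed.

Lemma bformDr d (M : 'M[R]_d) x y z :
  bform M x (y + z) = bform M x y + bform M x z.
Proof. by rewrite /bform mulmxDr mxE. Qed.

Lemma bformZr d (M : 'M[R]_d) x a y : bform M x (a *: y) = a * bform M x y.
Proof. by rewrite /bform -scalemxAr mxE. Qed.

Lemma bformNr d (M : 'M[R]_d) x y : bform M x (- y) = - bform M x y.
Proof. by rewrite -scaleN1r bformZr mulN1r. Qed.

Lemma bformDl d (M : 'M[R]_d) x y z :
  bform M (x + y) z = bform M x z + bform M y z.
Proof. by rewrite /bform linearD /= !mulmxDl mxE. Qed.

Lemma bformZl d (M : 'M[R]_d) x a y : bform M (a *: x) y = a * bform M x y.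
Proof. by rewrite /bform linearZ /= -!scalemxAl mxE. Qed.

Lemma bformMl k d (M : 'M[R]_k) (A : 'M[R]_(k, d)) x y :
  bform M (A *m x) (A *m y) = bform (A^T *m M *m A) x y.
Proof. by rewrite /bform trmx_mul !mulmxA. Qed.

Lemma qformD d (M : 'M[R]_d) x y : M^T = M ->
  qform M (x + y) = qform M x + 2 * bform M x y + qform M y.
Proof.
move=> sM; rewrite !qformE bformDl !bformDr (bformC y x sM).
by rewrite mulr_natl mulr2n !addrA.
Qed.

Lemma qformZ d (M : 'M[R]_d) a x : qform M (a *: x) = a ^+ 2 * qform M x.
Proof. by rewrite !qformE bformZl bformZr mulrA. Qed.

Lemma qformN d (M : 'M[R]_d) x : qform M (- x) = qform M x.
Proof. by rewrite -scaleN1r qformZ sqrrN expr1n mul1r. Qed.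

Lemma qform0 d (M : 'M[R]_d) : qform M 0 = 0.
Proof. by rewrite /qform mulmx0 mxE. Qed.

Lemma qform_mulmx k d (M : 'M[R]_k) (A : 'M[R]_(k, d)) x :
  qform M (A *m x) = qform (A^T *m M *m A) x.
Proof. exact: bformMl. Qed.

Lemma qformDm d (M N : 'M[R]_d) x : qform (M + N) x = qform M x + qform N x.
Proof. by rewrite /qform mulmxDr mulmxDl mxE. Qed.

Lemma qformNm d (M : 'M[R]_d) x : qform (- M) x = - qform M x.
Proof. by rewrite /qform mulmxN mulNmx mxE. Qed.

Lemma qformBm d (M N : 'M[R]_d) x : qform (M - N) x = qform M x - qform N x.
Proof. by rewrite qformDm qformNm. Qed.

Lemma qformZm d a (M : 'M[R]_d) x : qform (a *: M) x = a * qform M x.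
Proof. by rewrite /qform -scalemxAr -scalemxAl mxE. Qed.

Lemma qform0m d (x : 'cV[R]_d) : qform 0 x = 0.
Proof. by rewrite /qform mulmx0 mul0mx mxE. Qed.

(** Convergence, geometric decay and measurability of quadratic forms are all read off from this
    expansion into entries. *)
Lemma qform_sum d (M : 'M[R]_d) x :
  qform M x = \sum_i \sum_j M i j * (x i 0 * x j 0).
Proof.
rewrite /qform mxE exchange_big /=; apply: eq_bigr => j _.
rewrite mxE mulr_suml; apply: eq_bigr => i _.
by rewrite mxE; ring.
Qed.

Lemma psd0 d : psd (0 : 'M[R]_d).
Proof. by split=> [|x]; rewrite ?trmx0 // qform0m. Qed.

Lemma psd_congr k d (M : 'M[R]_k) (A : 'M[R]_(k, d)) :
  psd M -> psd (A^T *m M *m A).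
Proof.
move=> [sM pM]; split=> [|x]; last by rewrite -qform_mulmx.
by rewrite !trmx_mul trmxK sM mulmxA.
Qed.

Lemma pd_psd d (M : 'M[R]_d) : pd M -> psd M.
Proof.
move=> [sM pM]; split=> // x; have [->|x0] := eqVneq x 0; first by rewrite qform0.
exact/ltW/pM.
Qed.

Lemma pd_unit d (M : 'M[R]_d) : pd M -> M \in unitmx.
Proof.
move=> [sM pM]; rewrite -row_free_unit -kermx_eq0; apply/eqP/row_matrixP => i.
rewrite row0; apply/eqP/negPn/negP => k0.
have xM : row i (kermx M) *m M = 0 by rewrite -row_mul mulmx_ker row0.
have /pM : (row i (kermx M))^T != 0 by rewrite -trmx0 (inj_eq trmx_inj).
by rewrite /qform trmxK xM mul0mx mxE ltxx.
Qed.

(** Polarisation: equal forms have equal bilinear forms, whose values at basis vectors are the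
    entries. *)
Lemma sym_eq_qform d (M N : 'M[R]_d) :
  M^T = M -> N^T = N -> (forall x, qform M x = qform N x) -> M = N.
Proof.
move=> sM sN eqMN.
have eqb x y : bform M x y = bform N x y.
  have := eqMN (x + y); rewrite !qformD// !eqMN => /addIr /addrI.
  by apply: mulfI; rewrite pnatr_eq0.
apply/matrixP => i j.
have E (K : 'M[R]_d) : K i j = bform K (delta_mx i 0) (delta_mx j 0).
  by rewrite /bform trmx_delta -rowE -colE !mxE.
by rewrite !E eqb.
Qed.

End quadratic_forms.

(** * Riccati equations *)

Section riccati_operator.
Context (R : realType) (d k : nat) (beta : R) (beta_gt0 : 0 < beta).
Context (A : 'M[R]_d) (B : 'M[R]_(d, k)) (V : 'M[R]_d) (W : 'M[R]_k).
Hypotheses (psdV : psd V) (pdW : pd W).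
Implicit Types M N : 'M[R]_d.

(** The right-hand side of the algebraic Riccati equation, so that [riccati] unfolds to the
    fixed-point equation of this operator. It is the Bellman operator on quadratic value
    functions. *)
Definition riccati_op M : 'M[R]_d :=
  - (beta *: (A^T *m M *m B *m invmx (B^T *m M *m B + beta^-1 *: W)
                *m B^T *m M *m A)) + beta *: (A^T *m M *m A) + V.

Local Notation gain := (riccati_gain beta A B W).
Local Notation pivot M := (B^T *m M *m B + beta^-1 *: W).

Lemma pivot_pd M : psd M -> pd (pivot M).
Proof.
move=> pM; have [sBMB pBMB] := psd_congr B pM; split.
  by rewrite linearD linearZ /= sBMB pdW.1.
move=> x x0; rewrite qformDm qformZm ltr_wpDl// mulr_gt0 ?invr_gt0//.
exact: pdW.2.
Qed.

Lemma riccati_op_sym M : psd M -> (riccati_op M)^T = riccati_op M.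
Proof.
move=> pM; have [sS _] := pivot_pd pM; have [sM _] := pM.
rewrite /riccati_op !linearD /= linearN /= !linearZ /= !trmx_mul !trmxK trmx_inv.
by rewrite sS sM psdV.1 !mulmxA.
Qed.

(** As a function of u the one-step cost is quadratic, with minimiser [gain M *m x]. The factor beta
    is pulled out of the square, which is why W enters the pivot as beta^-1 W. *)
Lemma completed_square M x u : psd M ->
  qform V x + qform W u + beta * qform M (A *m x + B *m u) =
  qform (riccati_op M) x + beta * qform (pivot M) (u - gain M *m x).
Proof.
move=> pM; have pdS := pivot_pd pM; have uS := pd_unit pdS.
have [sM _] := pM; have [sS _] := pdS.
have b0 : beta != 0 by rewrite gt_eqF.
rewrite /riccati_op /riccati_gain mulNmx opprK; set S := pivot M in uS sS *.
rewrite [qform (_ + V) x]qformDm qformDm qformNm !qformZm; set G := B^T *m M *m A.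
have -> : invmx S *m B^T *m M *m A = invmx S *m G by rewrite !mulmxA.
have -> : A^T *m M *m B *m invmx S *m B^T *m M *m A = G^T *m invmx S *m G.
  by rewrite /G !trmx_mul trmxK sM !mulmxA.
rewrite (qformD _ _ sS) (qformD _ _ sM).
(* The pivot S cancels against its inverse, once in the cross term and once in the square of the
   minimiser. *)
have -> : bform S u (invmx S *m G *m x) = (u^T *m G *m x) 0 0.
  by rewrite /bform !mulmxA mulmxK.
have -> : qform S (invmx S *m G *m x) = qform (G^T *m invmx S *m G) x.
  by rewrite qform_mulmx trmx_mul trmx_inv sS !mulmxA mulmxKV.
have -> : qform S u = qform M (B *m u) + beta^-1 * qform W u.
  by rewrite {1}/S qformDm qformZm -qform_mulmx.
rewrite (bformC _ _ sM) /bform trmx_mul !mulmxA -/G qform_mulmx.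
field.
exact: b0.
Qed.

Lemma riccati_op_min M x u : psd M ->
  qform (riccati_op M) x <=
  qform V x + qform W u + beta * qform M (A *m x + B *m u).
Proof.
move=> pM; rewrite completed_square// lerDl mulr_ge0 ?(ltW beta_gt0)//.
by have [_] := pd_psd (pivot_pd pM); apply.
Qed.

Lemma riccati_opE M x : psd M ->
  qform (riccati_op M) x =
  qform V x + qform W (gain M *m x)
    + beta * qform M (A *m x + B *m (gain M *m x)).
Proof. by move=> pM; rewrite completed_square// subrr qform0 mulr0 addr0. Qed.

Lemma riccati_op_psd M : psd M -> psd (riccati_op M).
Proof.
move=> pM; split=> [|x]; first exact: riccati_op_sym.
rewrite riccati_opE// !addr_ge0 ?mulr_ge0 ?(ltW beta_gt0) ?psdV.2//.
  by have [_] := pd_psd pdW; apply.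
by have [_] := pM; apply.
Qed.

(** The input that is optimal for N is merely admissible for M, so it bounds the minimum for M from
    above. *)
Lemma riccati_op_homo M N : psd M -> psd N ->
  (forall x, qform M x <= qform N x) ->
  forall x, qform (riccati_op M) x <= qform (riccati_op N) x.
Proof.
move=> pM pN leMN x; rewrite (riccati_opE _ pN).
apply: le_trans (riccati_op_min x (gain N *m x) pM) _.
by rewrite lerD2l ler_wpM2l// ltW.
Qed.

(** The value matrix of the noise-free problem with t stages and zero terminal cost. *)
Definition value_iter (t : nat) : 'M[R]_d := iter t riccati_op 0.

Lemma value_iter_psd t : psd (value_iter t).
Proof. by elim: t => [|t IH]; [exact: psd0|exact: riccati_op_psd]. Qed.

Lemma value_iter_le_solution N : psd_riccati beta A B V W N ->
  forall t x, qform (value_iter t) x <= qform N x.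
Proof.
move=> [pN rN]; elim=> [x|t IH x]; first by rewrite qform0m; case: pN => _; apply.
rewrite [in leRHS]rN.
exact: (riccati_op_homo (value_iter_psd t)).
Qed.

Lemma value_iter_nondecreasing x :
  nondecreasing_seq (fun t => qform (value_iter t) x).
Proof.
apply/nondecreasing_seqP => t; elim: t x => [x|t IH x].
  by rewrite qform0m; case: (value_iter_psd 1) => _; apply.
exact: (riccati_op_homo (value_iter_psd t) (value_iter_psd t.+1) IH).
Qed.

End riccati_operator.

(** * Geometrically decaying sequences *)

Section geometric_decay.
Context (K : numFieldType).
Implicit Types u v : nat -> K.

(** The field is kept general because decay is first proved over the complex numbers and then
    transferred to the reals. *)
Definition geo u := exists C r : K,
  [/\ 0 <= C, 0 <= r, r < 1 & forall t, `|u t| <= C * r ^+ t].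

Lemma eq_geo u v : (forall t, u t = v t) -> geo u -> geo v.
Proof. by move=> /funext ->. Qed.

Lemma geo0 : geo (fun=> 0).
Proof. by exists 0, 0; split=> // t; rewrite normr0 mul0r. Qed.

(** The rate 1 - (1 - r)(1 - s) lies above both r and s and stays below 1, so r and s need not be
    compared. *)
Lemma geo_common u v : geo u -> geo v -> exists C r : K,
  [/\ 0 <= C, 0 <= r, r < 1 &
      forall t, `|u t| <= C * r ^+ t /\ `|v t| <= C * r ^+ t].
Proof.
move=> [C [r [C0 r0 r1 uC]]] [D [s [D0 s0 s1 vD]]].
have rs0 : 0 <= (1 - r) * (1 - s) by rewrite mulr_ge0// subr_ge0 ltW.
have rsr : r <= 1 - (1 - r) * (1 - s).
  rewrite -subr_ge0 [leRHS](_ : _ = s * (1 - r)); last by ring.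
  by rewrite mulr_ge0// subr_ge0 ltW.
have rss : s <= 1 - (1 - r) * (1 - s).
  rewrite -subr_ge0 [leRHS](_ : _ = r * (1 - s)); last by ring.
  by rewrite mulr_ge0// subr_ge0 ltW.
have q0 := le_trans r0 rsr.
exists (C + D), (1 - (1 - r) * (1 - s)); split=> //; first exact: addr_ge0.
  by rewrite ltrBlDr ltrDl mulr_gt0// subr_gt0.
move=> t; split.
  apply: le_trans (uC t) _; rewrite ler_pM ?exprn_ge0 ?lerDl//.
  by rewrite lerXn2r ?nnegrE.
apply: le_trans (vD t) _; rewrite ler_pM ?exprn_ge0 ?lerDr//.
by rewrite lerXn2r ?nnegrE.
Qed.

Lemma geoD u v : geo u -> geo v -> geo (fun t => u t + v t).
Proof.
move=> /geo_common H /H [C [r [C0 r0 r1 uv]]].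
exists (C + C), r; split; rewrite ?addr_ge0// => t.
by apply: le_trans (ler_normD _ _) _; have [ut vt] := uv t; rewrite mulrDl lerD.
Qed.

Lemma geoM u v : geo u -> geo v -> geo (fun t => u t * v t).
Proof.
move=> [C [r [C0 r0 r1 uC]]] [D [s [D0 s0 s1 vD]]].
exists (C * D), (r * s); split; rewrite ?mulr_ge0//.
  by apply: le_lt_trans s1; rewrite -[leRHS]mul1r ler_wpM2r// ltW.
by move=> t; rewrite normrM exprMn mulrACA ler_pM.
Qed.

Lemma geoZ c u : geo u -> geo (fun t => c * u t).
Proof.
move=> [C [r [C0 r0 r1 uC]]]; exists (`|c| * C), r; split; rewrite ?mulr_ge0//.
by move=> t; rewrite normrM -mulrA ler_wpM2l.
Qed.

Lemma geo_sum (I : Type) (s : seq I) (u : I -> nat -> K) :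
  (forall i, geo (u i)) -> geo (fun t => \sum_(i <- s) u i t).
Proof.
move=> gu; elim: s => [|i s IH].
  by apply: eq_geo geo0 => t; rewrite big_nil.
by apply: eq_geo (geoD (gu i) IH) => t; rewrite big_cons.
Qed.

(** A contracting first-order recursion driven by a decaying input has a decaying solution, at a
    rate slower than both. *)
Lemma geo_rec (z : K) u :
  `|z| < 1 -> geo (fun t => u t.+1 - z * u t) -> geo u.
Proof.
move=> z1 [C [r [C0 r0 r1 fC]]].
(* The division by 2 keeps q strictly above |z| even when r = 0. *)
pose q := 1 - (1 - r) * (1 - `|z|) / 2.
have z1' : 0 < 1 - `|z| by rewrite subr_gt0.
have r1' : 0 < 1 - r by rewrite subr_gt0.
have p0 : 0 < (1 - r) * (1 - `|z|) / 2 by rewrite divr_gt0 ?mulr_gt0.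
have q1 : q < 1 by rewrite ltrBlDr ltrDl.
have rq : r <= q.
  rewrite -subr_ge0 [leRHS](_ : _ = (1 - r) * (1 + `|z|) / 2).
    by rewrite mulr_ge0 ?invr_ge0// mulr_ge0 ?ltW// ltr_wpDr.
  by rewrite /q; field.
have zq : 0 < q - `|z|.
  rewrite [ltRHS](_ : _ = (1 - `|z|) * (1 + r) / 2).
    by rewrite divr_gt0 ?mulr_gt0// ltr_wpDr.
  by rewrite /q; field.
have q0 : 0 <= q := le_trans r0 rq.
(* Chosen so that D (q - |z|) >= C, which is what the induction step C q^t + |z| D q^t <= D q^(t+1)
   requires. *)
pose D := `|u 0%N| + C / (q - `|z|).
have D0 : 0 <= D by rewrite addr_ge0 ?divr_ge0// ltW.
exists D, q; split=> //; elim=> [|t IH].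
  by rewrite expr0 mulr1 lerDl divr_ge0// ltW.
rewrite -[u t.+1](subrK (z * u t)).
apply: le_trans (ler_normD _ _) _; rewrite normrM.
apply: le_trans (_ : C * q ^+ t + `|z| * (D * q ^+ t) <= _).
  rewrite lerD// ?ler_wpM2l//; apply: le_trans (fC t) _.
  by rewrite ler_wpM2l// lerXn2r ?nnegrE.
rewrite exprS -subr_ge0.
have -> : D * (q * q ^+ t) - (C * q ^+ t + `|z| * (D * q ^+ t)) =
  (D * (q - `|z|) - C) * q ^+ t by ring.
rewrite mulr_ge0 ?exprn_ge0// mulrDl divfK ?gt_eqF// addrK.
by rewrite mulr_ge0// ltW.
Qed.

End geometric_decay.

(** * Orbits of Schur stable matrices *)

Section spectral_radius.
Context (R : realType).
Local Notation C := R[i].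

(* By Cayley-Hamilton the sequence F^t v is annihilated by the product of the
   operators (shift - z) over the eigenvalues z; each factor is removed with
   geo_rec. *)
Lemma schur_stable_geo d (F : 'M[C]_d) (v : 'cV[C]_d) i :
  schur_stable F -> geo (fun t => iter t (mulmx F) v i 0).
Proof.
case: d => [|d] in F v i *; first by case: i.
move=> stF; pose P (s : seq C) := horner_mx F (\prod_(z <- s) ('X - z%:P)).
suff main (s : seq C) : {in s, forall z, `|z| < 1} -> forall w : 'cV[C]_d.+1,
    (forall j, geo (fun t => iter t (mulmx F) (P s *m w) j 0)) ->
    forall j, geo (fun t => iter t (mulmx F) w j 0).
  have [s defp] := closed_field_poly_normal (char_poly F).
  have Ps0 : P s = 0.
    have := Cayley_Hamilton F; rewrite defp (monicP (char_poly_monic F)) scale1r.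
    by [].
  apply: (main s) => [z zs|j].
    apply: stF; rewrite eigenvalue_root_char defp rootZ ?root_prod_XsubC//.
    by rewrite (monicP (char_poly_monic F)) oner_eq0.
  have iter0 t : iter t (mulmx F) (0 : 'cV[C]_d.+1) = 0.
    by elim: t => //= t ->; rewrite mulmx0.
  by apply: eq_geo (geo0 _) => t; rewrite Ps0 mul0mx iter0 mxE.
elim: s => [_ w|z s IH s1 w].
  by rewrite /P big_nil rmorph1 mul1mx.
(* The factor F - z is moved next to w, so that the induction hypothesis applies to (F - z) w, whose
   orbit is u_(t+1) - z u_t with u_t = F^t w. *)
rewrite /P big_cons mulrC rmorphM /= -[_ * _]/(_ *m _) -mulmxA => geow j.
have iterB t (a b : 'cV[C]_d.+1) :
    iter t (mulmx F) (a - b) = iter t (mulmx F) a - iter t (mulmx F) b.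
  by elim: t => //= t ->; rewrite mulmxBr.
have iterZ t (a : C) (b : 'cV[C]_d.+1) :
    iter t (mulmx F) (a *: b) = a *: iter t (mulmx F) b.
  by elim: t => //= t ->; rewrite scalemxAr.
apply: (@geo_rec _ z); first by apply: s1; rewrite mem_head.
have s1' : {in s, forall y, `|y| < 1}.
  by move=> y ys; apply: s1; rewrite in_cons ys orbT.
apply: eq_geo (IH s1' _ geow j) => t.
by rewrite rmorphB /= horner_mx_X horner_mx_C mulmxBl mul_scalar_mx iterB iterZ
  -iterSr !mxE.
Qed.

End spectral_radius.

Section real_geometric_decay.
Context (R : realType).

Lemma schur_stable_real_geo d (F : 'M[R]_d) (v : 'cV[R]_d) i :
  schur_stable (cmx F) -> geo (fun t => iter t (mulmx F) v i 0).
Proof.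
move=> /(@schur_stable_geo _ _ _ (cmx v) i) [C [r [C0 r0 r1 H]]].
have cmx_iter t : iter t (mulmx (cmx F)) (cmx v) = cmx (iter t (mulmx F) v).
  by elim: t => //= t ->; rewrite /cmx map_mxM.
(* The constant and the rate are nonnegative, hence real, and the bound descends to R. *)
have [c eC] : exists c, C = (c%:C)%C.
  by exists (complex.Re C); rewrite RRe_real ?ger0_real.
have [s er] : exists s, r = (s%:C)%C.
  by exists (complex.Re r); rewrite RRe_real ?ger0_real.
move: C0 r0 r1 H; rewrite eC er !lecR ltcR => c0 s0 s1 H.
exists c, s; split=> // t.
by rewrite -lecR; have := H t; rewrite cmx_iter mxE normc_def /= expr0n /= addr0 sqrtr_sqr
  rmorphM rmorphXn.
Qed.

Lemma geo_qform d (M : 'M[R]_d) (x : nat -> 'cV[R]_d) :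
  (forall i, geo (fun t => x t i 0)) -> geo (fun t => qform M (x t)).
Proof.
move=> gx.
apply: (@eq_geo _ (fun t => \sum_i \sum_j M i j * (x t i 0 * x t j 0))).
  by move=> t; rewrite qform_sum.
by apply: geo_sum => i; apply: geo_sum => j; apply/geoZ/geoM.
Qed.

Lemma geo_cvg0 (u : nat -> R) : geo u -> u @ \oo --> 0.
Proof.
move=> [C [r [C0 r0 r1 uC]]].
apply: norm_cvg0; apply: (@squeeze_cvgr _ _ _ _ (fun=> 0) (fun t => C * r ^+ t)).
- by apply: nearW => t; rewrite normr_ge0 uC.
- exact: cvg_cst.
- by apply: cvg_geometric; rewrite ger0_norm.
Qed.

Lemma geo_sum_bounded (u : nat -> R) : geo u ->
  exists b, forall t, \sum_(s < t) u s <= b.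
Proof.
move=> [C [r [C0 r0 r1 uC]]]; exists (C / (1 - r)) => t.
apply: le_trans (_ : \sum_(s < t) C * r ^+ s <= _).
  by apply: ler_sum => s _; exact: le_trans (ler_norm _) (uC s).
rewrite -mulr_sumr ler_wpM2l//.
have r1' : 0 < 1 - r by rewrite subr_gt0.
rewrite -[leRHS]mul1r ler_pdivlMr// mulrC -opprB mulNr -subrX1 opprB.
by rewrite lerBlDr lerDl exprn_ge0.
Qed.

End real_geometric_decay.

(** * Monotone limits of positive semi-definite matrices *)

Section monotone_limit.
Context (R : realType) (d : nat).

Lemma cvg_sum (I : Type) (s : seq I) (u : I -> nat -> R) (l : I -> R) :
  (forall i, u i @ \oo --> l i) ->
  (fun t => \sum_(i <- s) u i t) @ \oo --> \sum_(i <- s) l i.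
Proof. by move=> ul; apply: cvg_big => //; exact: add_continuous. Qed.

Lemma cvg_qform (Mk : nat -> 'M[R]_d) (M : 'M[R]_d) x :
  (forall i j, (fun t => Mk t i j) @ \oo --> M i j) ->
  (fun t => qform (Mk t) x) @ \oo --> qform M x.
Proof.
move=> cM; under eq_fun do rewrite qform_sum.
rewrite qform_sum; apply: cvg_sum => i; apply: cvg_sum => j.
by apply: cvgM => //; exact: cvg_cst.
Qed.

(** Polarisation writes each entry through the form at e_i + e_j, e_i and e_j, and these three real
    sequences are monotone and bounded. *)
Lemma psd_nondecreasing_cvg (Mk : nat -> 'M[R]_d) :
  (forall t, psd (Mk t)) ->
  (forall x, nondecreasing_seq (fun t => qform (Mk t) x)) ->
  (forall x, exists b, forall t, qform (Mk t) x <= b) ->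
  exists2 M : 'M[R]_d, psd M & forall i j, (fun t => Mk t i j) @ \oo --> M i j.
Proof.
move=> psdM incM bM.
have cq x : cvgn (fun t => qform (Mk t) x).
  apply: nondecreasing_is_cvgn => //; have [b hb] := bM x.
  by exists b => _ [t _ <-].
pose e i : 'cV[R]_d := delta_mx i 0.
have polar t i j : Mk t i j = 2^-1 * (qform (Mk t) (e i + e j)
    - qform (Mk t) (e i) - qform (Mk t) (e j)).
  have -> : Mk t i j = bform (Mk t) (e i) (e j).
    by rewrite /bform trmx_delta -rowE -colE !mxE.
  by rewrite qformD ?(psdM t).1//; field.
have cM i j : cvgn (fun t => Mk t i j).
  under eq_fun do rewrite polar.
  by apply: is_cvgM; [exact: is_cvg_cst|apply: is_cvgB; [apply: is_cvgB|]].
pose M := \matrix_(i, j) limn (fun t => Mk t i j).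
have cvgM i j : (fun t => Mk t i j) @ \oo --> M i j by rewrite mxE; exact: cM.
exists M => //; split.
  apply/matrixP => i j; rewrite !mxE; congr (lim (_ @ \oo)); apply/funext => t.
  by rewrite -[in LHS](psdM t).1 mxE.
move=> x; apply: (cvgr_to_ge (cvg_qform cvgM)).
by apply: nearW => t; case: (psdM t) => _; apply.
Qed.

Lemma qform_le_bound (D : 'M[R]_d) (y : 'cV[R]_d) b :
  (forall i, `|y i 0| <= b) -> qform D y <= (\sum_i \sum_j `|D i j|) * (b * b).
Proof.
move=> yb; rewrite qform_sum mulr_suml; apply: ler_sum => i _.
rewrite mulr_suml; apply: ler_sum => j _.
by apply: le_trans (ler_norm _) _; rewrite !normrM ler_wpM2l// ler_pM.
Qed.

(** With v = W^-1 e_i the coordinate u_i is the bilinear form of u and v; W[u + v] >= 0 and W[u - v]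
    >= 0 give 2 |u_i| <= W[u] + W[v]. Thus inputs of bounded cost are bounded. *)
Lemma pd_coord_bound (W : 'M[R]_d) i : pd W -> exists c, forall u : 'cV[R]_d,
  `|u i 0| <= c + qform W u.
Proof.
move=> pdW; pose v := invmx W *m (delta_mx i 0 : 'cV[R]_d).
have uW := pd_unit pdW; have [sW _] := pdW; have [_ pW] := pd_psd pdW.
have vu u : bform W u v = u i 0.
  by rewrite /bform /v -mulmxA mulKVmx// -colE !mxE.
exists (qform W v) => u.
have := pW (u + v); have := pW (u - v); have := pW u; have := pW v.
rewrite !(qformD _ _ sW) qformN bformNr vu.
by rewrite ler_norml => *; apply/andP; split; lra.
Qed.

End monotone_limit.

(** * Value iteration converges to a Riccati solution *)

Section riccati_solution.
Context (R : realType) (d k : nat) (beta : R) (beta_gt0 : 0 < beta).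
Context (A : 'M[R]_d) (B : 'M[R]_(d, k)) (V : 'M[R]_d) (W : 'M[R]_k).
Hypotheses (psdV : psd V) (pdW : pd W).
Hypothesis stab : stabilizable (Num.sqrt beta *: A) (Num.sqrt beta *: B).

Local Notation T := (riccati_op beta A B V W).
Local Notation Mk := (value_iter beta A B V W).

(** Moves the discount into the dynamics, the form in which stabilizability and detectability are
    stated. *)
Lemma discount_qform (M : 'M[R]_d) x :
  beta * qform M x = qform M (Num.sqrt beta *: x).
Proof. by rewrite qformZ sqr_sqrtr// ltW. Qed.

(** A stabilising feedback K may be used at every stage. The optimal t-stage cost is then at most
    the running cost V + K^T W K summed along a stable orbit, which is a sum of geometrically
    decaying terms. *)
Lemma value_iter_bounded x : exists b, forall t, qform (Mk t) x <= b.
Proof.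
have [K stF] := stab; set F := _ + _ in stF.
pose c := V + K^T *m W *m K.
have geoF : geo (fun t => qform c (iter t (mulmx F) x)).
  by apply: geo_qform => i; exact: schur_stable_real_geo.
have [b hb] := geo_sum_bounded geoF.
exists b => t; apply: le_trans (hb t).
elim: t x {geoF b hb} => [x|t IH x]; first by rewrite qform0m big_ord0.
rewrite big_ord_recl /=.
have pMt := value_iter_psd beta_gt0 A B psdV pdW t.
apply: le_trans (riccati_op_min beta_gt0 A B V pdW x (K *m x) pMt) _.
rewrite qform_mulmx -qformDm -/c lerD2l discount_qform.
have -> : Num.sqrt beta *: (A *m x + B *m (K *m x)) = F *m x.
  by rewrite mulmxDl scalerDr -!scalemxAl -!mulmxA.
apply: le_trans (IH _) _; apply: ler_sum => s _.
by rewrite -iterSr.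
Qed.

Lemma value_iter_limit : exists M, [/\ psd M, T M = M &
  forall i j, (fun t => Mk t i j) @ \oo --> M i j].
Proof.
have [M pM cM] := psd_nondecreasing_cvg (value_iter_psd beta_gt0 A B psdV pdW)
  (value_iter_nondecreasing beta_gt0 A B psdV pdW) value_iter_bounded.
exists M; split=> //.
have leM t x : qform (Mk t) x <= qform M x.
  have cq := cvg_qform (x := x) cM.
  rewrite -(cvg_lim (@Rhausdorff R) cq).
  apply: nondecreasing_cvgn_le; first exact: value_iter_nondecreasing.
  by apply/cvg_ex; exists (qform M x).
have pMk := value_iter_psd beta_gt0 A B psdV pdW.
apply: sym_eq_qform;
  [exact: (riccati_op_psd beta_gt0 A B psdV pdW pM).1|exact: pM.1|move=> x].
apply/eqP; rewrite eq_le; apply/andP; split; last first.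
  (* M <= T M: every iterate M_(t+1) = T M_t lies below T M by monotonicity. *)
  apply: (cvgr_to_le (cvg_qform cM)).
  apply: nearW => -[|t]; last first.
    exact: (riccati_op_homo beta_gt0 A B V pdW (pMk t) pM (leM t)).
  by rewrite qform0m; case: (riccati_op_psd beta_gt0 A B psdV pdW pM) => _; apply.
(* The minimising inputs u_t stay in a bounded set because W is definite, so the
   error (M - M_t)[A x + B u_t] vanishes. *)
pose u t := riccati_gain beta A B W (Mk t) *m x.
pose y t := A *m x + B *m u t.
have uW t : qform W (u t) <= qform M x.
  apply: le_trans (leM t.+1 x); rewrite /= riccati_opE// -addrA addrCA lerDl.
  rewrite addr_ge0 ?psdV.2// mulr_ge0 ?(ltW beta_gt0)//.
  by case: (pMk t) => _; apply.
have [b yb] : exists b, forall t i, `|y t i 0| <= b.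
  have /choice [c hc] (j : 'I_k) : exists c, forall v : 'cV[R]_k,
      `|v j 0| <= c + qform W v by exact: pd_coord_bound.
  pose bnd i := `|(A *m x) i 0| + \sum_j `|B i j| * (c j + qform M x).
  have bnd_ge t i : `|y t i 0| <= bnd i.
    rewrite /y !mxE; apply: le_trans (ler_normD _ _) _.
    rewrite /bnd mxE lerD2l; apply: le_trans (ler_norm_sum _ _ _) _.
    apply: ler_sum => j _; rewrite normrM ler_wpM2l//.
    by apply: le_trans (hc j _) _; rewrite lerD2l.
  exists (\sum_i bnd i) => t i; apply: le_trans (bnd_ge t i) _.
  rewrite (bigD1 i)//= lerDl; apply: sumr_ge0 => j _.
  exact: le_trans (normr_ge0 _) (bnd_ge 0%N j).
pose eps t := beta * ((\sum_i \sum_j `|(M - Mk t) i j|) * (b * b)).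
(* The input u_t is optimal for M_t and admissible for M; the two one-step costs differ only by beta
   (M - M_t)[y_t]. *)
have Tle t : qform (T M) x <= qform (Mk t.+1) x + eps t.
  apply: le_trans (riccati_op_min beta_gt0 A B V pdW x (u t) pM) _.
  rewrite /= [qform (T (Mk t)) x]riccati_opE// -/(u t) -/(y t) -!addrA !lerD2l.
  rewrite /eps -mulrDr ler_wpM2l ?(ltW beta_gt0)// -lerBlDl -qformBm.
  exact: qform_le_bound.
have cl : (fun t => qform (Mk t.+1) x + eps t) @ \oo -->
    qform M x + beta * ((\sum_(i < d) \sum_(j < d) `|0 : R|) * (b * b)).
  apply: cvgD.
    by have := cvg_qform (x := x) cM; rewrite -(cvg_shiftS (fun t => qform (Mk t) x)).
  apply: cvgM; first exact: cvg_cst.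
  apply: cvgM; last exact: cvg_cst.
  apply: cvg_sum => i; apply: cvg_sum => j; apply: cvg_norm.
  rewrite -(subrr (M i j)).
  under eq_fun do rewrite !mxE.
  by apply: cvgB; [exact: cvg_cst|exact: cM].
have z0 : \sum_(i < d) \sum_(j < d) `|0 : R| = 0.
  by rewrite big1// => i _; rewrite big1// => j _; rewrite normr0.
by move: cl; rewrite z0 mul0r mulr0 addr0 => /cvgr_to_ge; apply; exact: nearW.
Qed.

End riccati_solution.

(** * Eigenvectors, Hermitian forms and square roots over the complex numbers *)

Section right_eigenvectors.
Context (F : fieldType) (d : nat).

Lemma eigenvalue_tr (A : 'M[F]_d) z : eigenvalue A^T z = eigenvalue A z.
Proof.
rewrite !eigenvalue_root_char /char_poly -det_tr; congr (root (\det _) z).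
by apply/matrixP => i j; rewrite !mxE eq_sym.
Qed.

(** [eigenvalue] speaks of row eigenvectors, whereas the dynamics act on columns; a matrix and its
    transpose share their characteristic polynomial. *)
Lemma eigenvalue_colP (A : 'M[F]_d) z :
  reflect (exists2 v : 'cV_d, A *m v = z *: v & v != 0) (eigenvalue A z).
Proof.
rewrite -eigenvalue_tr; apply: (iffP eigenvalueP) => -[v vA v0].
  exists v^T; last by rewrite -trmx0 (inj_eq trmx_inj).
  by rewrite -[A]trmxK -trmx_mul vA linearZ.
exists v^T; last by rewrite -trmx0 (inj_eq trmx_inj).
by rewrite -trmx_mul vA linearZ.
Qed.

End right_eigenvectors.

Section complexified_forms.
Context (R : realType).
Local Notation C := R[i].

(** When M[x] = 0, the form at y + a x is affine in a, and it can stay nonnegative only if its slope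
    vanishes. *)
Lemma psd_qform_eq0 d (M : 'M[R]_d) x : psd M -> qform M x = 0 -> M *m x = 0.
Proof.
move=> [sM pM] Mx0; have b0 y : bform M y x = 0.
  apply/eqP/negPn/negP => bn0.
  (* This value of a makes the form at y + a x equal to -1. *)
  pose a := - (qform M y + 1) / (2 * bform M y x).
  have := pM (y + a *: x).
  rewrite (qformD _ _ sM) bformZr qformZ Mx0 mulr0 addr0.
  have -> : 2 * (a * bform M y x) = - (qform M y + 1) by rewrite /a; field.
  by rewrite opprD addNKr ler0N1.
apply/matrixP => i j; rewrite ord1 [RHS]mxE.
by have := b0 (delta_mx i 0); rewrite /bform trmx_delta -rowE -row_mul mxE.
Qed.

Definition Re_mx m n (A : 'M[C]_(m, n)) : 'M[R]_(m, n) := map_mx (@complex.Re R) A.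
Definition Im_mx m n (A : 'M[C]_(m, n)) : 'M[R]_(m, n) := map_mx (@complex.Im R) A.

Lemma Re_cmx_mul m n p (A : 'M[R]_(m, n)) (v : 'M[C]_(n, p)) :
  Re_mx (cmx A *m v) = A *m Re_mx v.
Proof.
apply/matrixP => i j; rewrite !mxE (raddf_sum (@complex.Re R : Rcomplex R -> R)).
apply: eq_bigr => l _; rewrite !mxE; case: (v l j) => a b /=.
by rewrite mul0r subr0.
Qed.

Lemma Im_cmx_mul m n p (A : 'M[R]_(m, n)) (v : 'M[C]_(n, p)) :
  Im_mx (cmx A *m v) = A *m Im_mx v.
Proof.
apply/matrixP => i j; rewrite !mxE (raddf_sum (@complex.Im R : Rcomplex R -> R)).
apply: eq_bigr => l _; rewrite !mxE; case: (v l j) => a b /=.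
by rewrite mul0r addr0.
Qed.

Lemma cmx_mul_eq0 m n (A : 'M[R]_(m, n)) (v : 'cV[C]_n) :
  A *m Re_mx v = 0 -> A *m Im_mx v = 0 -> cmx A *m v = 0.
Proof.
rewrite -Re_cmx_mul -Im_cmx_mul => /matrixP vR /matrixP vI.
apply/matrixP => i j; have := vR i j; have := vI i j; rewrite !mxE.
by case: (\sum_(_ | _) _) => a b /= -> ->.
Qed.

(* The Hermitian form v^* M v, which is real for M symmetric. *)
Definition hform d (M : 'M[R]_d) (v : 'cV[C]_d) : R :=
  qform M (Re_mx v) + qform M (Im_mx v).

(** The factor is |z|^2: the cross terms between real and imaginary parts cancel by symmetry of
    M. *)
Lemma hformZ d (M : 'M[R]_d) (z : C) v : M^T = M ->
  hform M (z *: v) = (complex.Re z ^+ 2 + complex.Im z ^+ 2) * hform M v.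
Proof.
move=> sM; rewrite /hform; case: z => p q /=.
have -> : Re_mx ((p +i* q)%C *: v) = p *: Re_mx v + (- q) *: Im_mx v.
  by apply/matrixP => i j; rewrite !mxE; case: (v i j) => a b /=; rewrite mulNr.
have -> : Im_mx ((p +i* q)%C *: v) = p *: Im_mx v + q *: Re_mx v.
  by apply/matrixP => i j; rewrite !mxE; case: (v i j).
rewrite !(qformD _ _ sM) !qformZ !bformZl !bformZr (bformC (Im_mx v) _ sM).
by ring.
Qed.

Lemma sum4_le0 (a b c e : R) : 0 <= a -> 0 <= b -> 0 <= c -> 0 <= e ->
  a + b + (c + e) <= 0 -> [/\ a = 0, b = 0, c = 0 & e = 0].
Proof. by move=> *; split; lra. Qed.

(** In the coordinates U v of an eigenbasis, l_i (U v)_i = 0 forces sqrt(l_i) (U v)_i = 0, whatever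
    the sign of l_i. *)
Lemma sqrtmx_mul_eq0 d (M : 'M[R]_d) (v : 'cV[C]_d) :
  M^T = M -> cmx M *m v = 0 -> sqrtmx M *m v = 0.
Proof.
move=> sM Mv0; rewrite /sqrtmx; set U := spectral.spectralmx _.
have uU : U \in unitmx by exact: spectral.spectral_unit.
have /spectral.orthomx_spectralP defM : cmx M \is spectral.normalmx.
  apply: spectral.symmetric_normalmx.
    apply/sesquilinear.is_hermitianmxP.
    by rewrite expr0 scale1r map_mx_id//; apply/matrixP => i j; rewrite !mxE -{1}sM mxE.
  by apply/mxOverP => i j; rewrite mxE; apply/complex_realP; exists (M i j).
have : invmx U *m (diag_mx (spectral.spectral_diag (cmx M)) *m (U *m v)) = 0.
  by rewrite !mulmxA -defM.
move=> /(congr1 (mulmx U)); rewrite mulKVmx// mulmx0 => /matrixP DUv.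
rewrite -!mulmxA.
suff -> : diag_mx (map_mx sqrtC (spectral.spectral_diag (cmx M))) *m (U *m v) = 0.
  by rewrite mulmx0.
apply/matrixP => i j; have := DUv i j; rewrite !mul_diag_mx !mxE.
by move/eqP; rewrite mulf_eq0 => /orP[/eqP ->|/eqP ->]; rewrite ?sqrtC0 ?mul0r ?mulr0.
Qed.

End complexified_forms.

(** * Stability of the closed loop and uniqueness of the Riccati solution *)

Section riccati_uniqueness.
Context (R : realType) (d k : nat) (beta : R) (beta_gt0 : 0 < beta).
Context (A : 'M[R]_d) (B : 'M[R]_(d, k)) (V : 'M[R]_d) (W : 'M[R]_k).
Hypotheses (psdV : psd V) (pdW : pd W).

Local Notation T := (riccati_op beta A B V W).
Local Notation Mk := (value_iter beta A B V W).

Definition closed_loop M : 'M[R]_d :=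
  Num.sqrt beta *: A + Num.sqrt beta *: B *m riccati_gain beta A B W M.

Lemma closed_loopE M (x : 'cV[R]_d) :
  Num.sqrt beta *: (A *m x + B *m (riccati_gain beta A B W M *m x)) = closed_loop M *m x.
Proof. by rewrite mulmxDl scalerDr -!scalemxAl -!mulmxA. Qed.

Lemma solution_lyapunov M x : psd_riccati beta A B V W M ->
  qform M x = qform V x + qform W (riccati_gain beta A B W M *m x)
    + qform M (closed_loop M *m x).
Proof.
move=> [pM eM]; rewrite [in LHS]eM -/(T M) (riccati_opE beta_gt0 A B V pdW x pM).
by rewrite discount_qform// closed_loopE.
Qed.

(** Suppose v is an eigenvector of the closed loop with |z| >= 1. The Lyapunov identity for the
    Hermitian forms leaves no room for the running cost, so V v = 0 and L v = 0: an unstable mode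
    that the output does not see, against detectability. *)
Lemma solution_stable M : psd_riccati beta A B V W M ->
  detectable (Num.sqrt beta *: A) (sqrtmx V) ->
  schur_stable (cmx (closed_loop M)).
Proof.
move=> solM [K stK] z /eigenvalue_colP [v Fv v0].
rewrite real_ltNge ?normr_real ?real1//; apply/negP => z1.
have [pM _] := solM; have [sM pM0] := pM; have [sV pV0] := psdV.
have [sW pW0] := pd_psd pdW.
set L := riccati_gain beta A B W M.
have lyap : hform M v = hform V v + (qform W (L *m Re_mx v) + qform W (L *m Im_mx v))
    + hform M (cmx (closed_loop M) *m v).
  rewrite /hform Re_cmx_mul Im_cmx_mul (solution_lyapunov (Re_mx v) solM).
  by rewrite (solution_lyapunov (Im_mx v) solM) -/L; ring.
have zz : 1 <= complex.Re z ^+ 2 + complex.Im z ^+ 2.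
  rewrite -lecR rmorph1 add_Re2_Im2.
  by rewrite exprn_ege1.
have hM : 0 <= hform M v by rewrite addr_ge0.
have hM' : hform M v <= hform M (cmx (closed_loop M) *m v).
  by rewrite Fv hformZ// ler_peMl.
have : hform V v + (qform W (L *m Re_mx v) + qform W (L *m Im_mx v)) <= 0.
  by rewrite -(lerD2r (hform M (cmx (closed_loop M) *m v))) add0r -lyap.
case/sum4_le0 => // VR VI WR WI.
have pdW0 (y : 'cV[R]_k) : qform W y = 0 -> y = 0.
  by move=> y0; apply/eqP/negPn/negP => /(pdW.2); rewrite y0 ltxx.
have Lv : cmx L *m v = 0 by apply: cmx_mul_eq0; exact: pdW0.
have Vv : cmx V *m v = 0 by apply: cmx_mul_eq0; exact: psd_qform_eq0.
(* Neither the injection K nor the feedback L acts on v, so the injected system and the closed loop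
   agree on v. *)
have /stK : eigenvalue (cmx (Num.sqrt beta *: A) + K *m sqrtmx V) z.
  apply/eigenvalue_colP; exists v => //.
  rewrite mulmxDl -mulmxA sqrtmx_mul_eq0// mulmx0 addr0 -Fv /closed_loop.
  by rewrite /cmx map_mxD map_mxM mulmxDl -mulmxA -/(cmx L) Lv mulmx0 addr0.
by rewrite real_ltNge ?normr_real ?real1// z1.
Qed.

Lemma stable_qform_cvg0 (M F : 'M[R]_d) x : schur_stable (cmx F) ->
  (fun t => qform M (iter t (mulmx F) x)) @ \oo --> 0.
Proof.
move=> stF; apply/geo_cvg0/geo_qform => i.
exact: schur_stable_real_geo.
Qed.

(** The gain of M is merely admissible for N, hence D = N - M satisfies D[y] <= D[F y] for the
    closed loop F of M. Iterating, D[x] <= D[F^t x], which tends to 0. *)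
Lemma solution_le_stable M N : psd_riccati beta A B V W M ->
  psd_riccati beta A B V W N -> schur_stable (cmx (closed_loop M)) ->
  forall x, qform N x <= qform M x.
Proof.
move=> solM solN stF x; have [pN eN] := solN.
have step y : qform (N - M) y <= qform (N - M) (closed_loop M *m y).
  have : qform N y <= qform V y + qform W (riccati_gain beta A B W M *m y)
      + qform N (closed_loop M *m y).
    rewrite [in leLHS]eN -/(T N) -closed_loopE -discount_qform//.
    exact: riccati_op_min.
  by rewrite !qformBm (solution_lyapunov y solM) => ?; lra.
rewrite -subr_le0 -qformBm.
have := stable_qform_cvg0 (N - M) x stF => /cvgr_to_ge; apply.
apply: nearW; elim=> [//|t IH]; exact: le_trans IH (step _).
Qed.

Lemma riccati_unique M N : detectable (Num.sqrt beta *: A) (sqrtmx V) ->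
  psd_riccati beta A B V W M -> psd_riccati beta A B V W N -> M = N.
Proof.
move=> det solM solN; apply: sym_eq_qform; [exact: solM.1.1|exact: solN.1.1|].
move=> x; apply/eqP; rewrite eq_le.
by rewrite !solution_le_stable//; exact: solution_stable.
Qed.

Hypothesis stab : stabilizable (Num.sqrt beta *: A) (Num.sqrt beta *: B).

(** Value iteration starts at 0 and is monotone, so it stays below every positive semi-definite
    solution, and so does its limit. *)
Lemma exists_least_psd_riccati : exists2 M, least_psd_riccati beta A B V W M &
  forall x, (fun t => qform (Mk t) x) @ \oo --> qform M x.
Proof.
have [M [pM eM cM]] := value_iter_limit beta_gt0 psdV pdW stab.
exists M => [|x]; last exact: cvg_qform.
split; first by split.
move=> N solN; split; first by rewrite linearB /= pM.1 solN.1.1.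
move=> x; rewrite qformBm subr_ge0.
have := cvg_qform (x := x) cM => /cvgr_to_le; apply; apply: nearW => t.
exact: value_iter_le_solution.
Qed.

(** Two least solutions lie below each other, so M coincides with the limit of the iterates. *)
Lemma value_iter_cvg_least M : least_psd_riccati beta A B V W M ->
  forall x, (fun t => qform (Mk t) x) @ \oo --> qform M x.
Proof.
move=> [solM minM]; have [N [solN minN] cN] := exists_least_psd_riccati.
suff -> : M = N by [].
apply: sym_eq_qform; [exact: solM.1.1|exact: solN.1.1|move=> x].
have [_ /(_ x)] := minM _ solN; have [_ /(_ x)] := minN _ solM.
by rewrite !qformBm; lra.
Qed.

Lemma value_iter_cvg_detectable M : detectable (Num.sqrt beta *: A) (sqrtmx V) ->
  psd_riccati beta A B V W M ->
  forall x, (fun t => qform (Mk t) x) @ \oo --> qform M x.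
Proof.
move=> det solM; have [N [solN _] cN] := exists_least_psd_riccati.
by rewrite (riccati_unique det solM solN).
Qed.

End riccati_uniqueness.

(** * Deviations and aggregate *)

Section joint_coordinates.
Context (R : realType) (d n : nat).
Implicit Types S : 'M[R]_(d, 1 + n).

Definition deviation S (i : 'I_n) : 'cV[R]_d := follower S i - mean_field S.
Definition aggregate S : 'cV[R]_(d + d) := col_mx (leader S) (mean_field S).

(** The polar form of [joint_form]; linear in its second argument, it is the cross term whose
    expectation vanishes for centred noise. *)
Definition joint_bform (M : 'M[R]_d) (N : 'M[R]_(d + d)) S S' : R :=
  n%:R^-1 * (\sum_(i < n) bform M (deviation S i) (deviation S' i))
  + bform N (aggregate S) (aggregate S').

Definition joint_form (M : 'M[R]_d) (N : 'M[R]_(d + d)) S : R :=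
  n%:R^-1 * (\sum_(i < n) qform M (deviation S i)) + qform N (aggregate S).

Lemma leader_linear a S S' : leader (a *: S + S') = a *: leader S + leader S'.
Proof. by apply/matrixP => i j; rewrite !mxE. Qed.

Lemma follower_linear a S S' i :
  follower (a *: S + S') i = a *: follower S i + follower S' i.
Proof. by apply/matrixP => k j; rewrite !mxE. Qed.

Lemma mean_field_linear a S S' :
  mean_field (a *: S + S') = a *: mean_field S + mean_field S'.
Proof.
rewrite /mean_field scalerA mulrC -scalerA -scalerDr; congr (_ *: _).
rewrite scaler_sumr -big_split /=; apply: eq_bigr => i _.
exact: follower_linear.
Qed.

Lemma deviation_linear a S S' i :
  deviation (a *: S + S') i = a *: deviation S i + deviation S' i.
Proof.
by rewrite /deviation follower_linear mean_field_linear scalerBr opprD addrACA.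
Qed.

Lemma aggregate_linear a S S' :
  aggregate (a *: S + S') = a *: aggregate S + aggregate S'.
Proof.
by rewrite /aggregate leader_linear mean_field_linear scale_col_mx add_col_mx.
Qed.

Lemma deviationD S S' i : deviation (S + S') i = deviation S i + deviation S' i.
Proof. by have := deviation_linear 1 S S' i; rewrite !scale1r. Qed.

Lemma aggregateD S S' : aggregate (S + S') = aggregate S + aggregate S'.
Proof. by have := aggregate_linear 1 S S'; rewrite !scale1r. Qed.

Lemma deviationN S i : deviation (- S) i = - deviation S i.
Proof.
have := deviation_linear (-1) S S i; rewrite !scaleN1r !addNr => d0.
by have := deviation_linear (-1) S 0 i; rewrite !scaleN1r d0 !addr0.
Qed.

Lemma aggregateN S : aggregate (- S) = - aggregate S.
Proof.
have := aggregate_linear (-1) S S; rewrite !scaleN1r !addNr => d0.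
by have := aggregate_linear (-1) S 0; rewrite !scaleN1r d0 !addr0.
Qed.

Lemma joint_bform_linear M N S a T T' :
  joint_bform M N S (a *: T + T') = a * joint_bform M N S T + joint_bform M N S T'.
Proof.
rewrite /joint_bform aggregate_linear bformDr bformZr mulrDr addrACA; congr (_ + _).
rewrite mulrCA -mulrDr; congr (_ * _); rewrite mulr_sumr -big_split /=.
by apply: eq_bigr => i _; rewrite deviation_linear bformDr bformZr.
Qed.

Lemma joint_bformNr M N S T : joint_bform M N S (- T) = - joint_bform M N S T.
Proof.
have b0 : joint_bform M N S 0 = 0.
  by have := joint_bform_linear M N S (-1) 0 0; rewrite scaler0 addr0 mulN1r addNr.
by have := joint_bform_linear M N S (-1) T 0; rewrite addr0 b0 addr0 scaleN1r mulN1r.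
Qed.

Lemma joint_formD M N S S' : M^T = M -> N^T = N ->
  joint_form M N (S + S') =
  joint_form M N S + 2 * joint_bform M N S S' + joint_form M N S'.
Proof.
move=> sM sN; rewrite /joint_form /joint_bform.
rewrite aggregateD (qformD _ _ sN).
have -> : \sum_(i < n) qform M (deviation (S + S') i) =
    \sum_(i < n) qform M (deviation S i)
    + 2 * (\sum_(i < n) bform M (deviation S i) (deviation S' i))
    + \sum_(i < n) qform M (deviation S' i).
  rewrite mulr_sumr -!big_split /=; apply: eq_bigr => i _.
  by rewrite deviationD (qformD _ _ sM).
by ring.
Qed.

Lemma joint_form_ge0 M N S : psd M -> psd N -> 0 <= joint_form M N S.
Proof.
move=> pM pN; rewrite addr_ge0 ?pN.2// mulr_ge0 ?invr_ge0//.
by apply: sumr_ge0 => i _; exact: pM.2.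
Qed.

Lemma joint_formN M N S : joint_form M N (- S) = joint_form M N S.
Proof.
rewrite /joint_form aggregateN qformN; congr (_ * _ + _).
by apply: eq_bigr => i _; rewrite deviationN qformN.
Qed.

End joint_coordinates.

(** * Averages over the followers *)

Section mean_identities.
Context (R : realType) (d n : nat) (n_gt0 : (0 < n)%N).
Let n0 : n%:R != 0 :> R. Proof. by rewrite pnatr_eq0 -lt0n. Qed.

Lemma mean_const (T : lmodType R) (c : T) : n%:R^-1 *: (\sum_(i < n) c) = c.
Proof. by rewrite sumr_const card_ord -[c *+ n]scaler_nat scalerA mulVf// scale1r. Qed.

Lemma sum_deviation (S : 'M[R]_(d, 1 + n)) : \sum_(i < n) deviation S i = 0.
Proof.
rewrite sumrB sumr_const card_ord -scaler_nat /mean_field.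
by rewrite scalerA mulfV// scale1r subrr.
Qed.

(** The parallel axis identity: the cross term disappears because the deviations sum to zero. *)
Lemma mean_qform (M : 'M[R]_d) (S : 'M[R]_(d, 1 + n)) c : M^T = M ->
  n%:R^-1 * (\sum_(i < n) qform M (follower S i - c)) =
  n%:R^-1 * (\sum_(i < n) qform M (deviation S i)) + qform M (mean_field S - c).
Proof.
move=> sM.
have -> : \sum_(i < n) qform M (follower S i - c) =
    \sum_(i < n) (qform M (deviation S i)
     + 2 * bform M (mean_field S - c) (deviation S i) + qform M (mean_field S - c)).
  apply: eq_bigr => i _; rewrite (bformC _ _ sM) -(qformD _ _ sM).
  by rewrite /deviation addrA subrK.
rewrite !big_split /= -mulr_sumr.
have -> : \sum_(i < n) bform M (mean_field S - c) (deviation S i) = 0.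
  have b0 : bform M (mean_field S - c) 0 = 0 by rewrite /bform mulmx0 mxE.
  rewrite -[RHS]b0 -(sum_deviation S); apply/esym.
  exact: (big_morph _ (bformDr M _) b0).
rewrite mulr0 addr0 mulrDr; congr (_ + _).
by rewrite sumr_const card_ord -[qform _ _ *+ n]mulr_natl mulrA mulVf// mul1r.
Qed.

(** For fixed j the parallel axis identity with c = x^j turns the inner sum into n (v +
    H[x^j - xbar]); summing over j gives 2 n^2 v. *)
Lemma pairwise_qform (H : 'M[R]_d) (S : 'M[R]_(d, 1 + n)) : H^T = H ->
  (2 * n%:R ^+ 2)^-1 *
    (\sum_(i < n) \sum_(j < n) qform H (follower S i - follower S j)) =
  n%:R^-1 * (\sum_(i < n) qform H (deviation S i)).
Proof.
move=> sH; set v := RHS.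
rewrite exchange_big /=.
have E j : n%:R^-1 * (\sum_(i < n) qform H (follower S i - follower S j)) =
    v + qform H (deviation S j).
  by rewrite mean_qform// -[in RHS]qformN opprB.
have -> : \sum_(j < n) \sum_(i < n) qform H (follower S i - follower S j) =
    n%:R * (\sum_(j < n) (v + qform H (deviation S j))).
  rewrite mulr_sumr; apply: eq_bigr => j _.
  by rewrite -E mulrA mulfV// mul1r.
rewrite big_split /= sumr_const card_ord -[v *+ n]mulr_natl.
have -> : \sum_(i < n) qform H (deviation S i) = n%:R * v.
  by rewrite /v mulrA mulfV// mul1r.
by field.
Qed.

End mean_identities.

Section block_forms.
Context (R : realType) (d : nat).

Lemma qform_block (A B C D : 'M[R]_d) (x y : 'cV[R]_d) :
  qform (block_mx A B C D) (col_mx x y) =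
  qform A x + (x^T *m B *m y) 0 0 + (y^T *m C *m x) 0 0 + qform D y.
Proof.
rewrite /qform tr_col_mx mul_row_block mul_row_col !mulmxDl !mxE.
by ring.
Qed.

Lemma qform_block_diag (A D : 'M[R]_d) (x y : 'cV[R]_d) :
  qform (block_mx A 0 0 D) (col_mx x y) = qform A x + qform D y.
Proof. by rewrite qform_block !mulmx0 !mul0mx !mxE !addr0. Qed.

Lemma block_diag_pd (A D : 'M[R]_d) : pd A -> pd D -> pd (block_mx A 0 0 D).
Proof.
move=> pA pD; split; first by rewrite tr_block_mx !trmx0 pA.1 pD.1.
move=> z; rewrite -[z]vsubmxK; move: (usubmx z) (dsubmx z) => x y.
rewrite qform_block_diag.
have [x0|x0 _] := eqVneq x 0.
  have [->|y0 _] := eqVneq y 0; first by rewrite x0 col_mx0 eqxx.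
  by rewrite ltr_wpDl ?pD.2//; case: (pd_psd pA) => _; apply.
by rewrite ltr_wpDr ?pA.2//; case: (pd_psd pD) => _; apply.
Qed.

End block_forms.

(** * Decoupling of the dynamics and of the stage cost *)

Section joint_dynamics.
Context (R : realType) (dx du n : nat) (n_gt0 : (0 < n)%N).
Context (m : lf_model R dx du).
Hypotheses (Q_sym : (mQ m)^T = mQ m) (P_sym : (mP m)^T = mP m)
  (R_sym : (mR m)^T = mR m) (H_sym : (mH m)^T = mH m).
Implicit Types (S : 'M[R]_(dx, 1 + n)) (U : 'M[R]_(du, 1 + n)).

Lemma leader_row_mx d (x : 'cV[R]_d) (y : 'M[R]_(d, n)) : leader (row_mx x y) = x.
Proof. exact: row_mxKl. Qed.

Lemma follower_row_mx d (x : 'cV[R]_d) (y : 'I_n -> 'cV[R]_d) i :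
  follower (row_mx x (\matrix_(a < d, j < n) y j a 0)) i = y i.
Proof.
by apply/matrixP => a b; rewrite /follower row_mxKr !mxE ord1.
Qed.

(** Actions are packed like states, so that [deviation], [aggregate] and [joint_form] apply to them
    as well. *)
Definition joint_action (g : strategy R dx du n) t S : 'M[R]_(du, 1 + n) :=
  row_mx (leader_action g t S) (\matrix_(a < du, i < n) follower_action g t S i a 0).

Definition drift S U : 'M[R]_(dx, 1 + n) :=
  row_mx (mA0 m *m leader S + mB0 m *m leader U + mD0 m *m mean_field S)
    (\matrix_(a < dx, i < n)
       (mA m *m follower S i + mB m *m follower U i
          + mD m *m mean_field S + mE m *m leader S) a 0).

Lemma step_drift g t S N : step m g t S N = drift S (joint_action g t S) + N.
Proof.
rewrite /step /drift -[N in RHS]hsubmxK add_row_mx leader_row_mx; congr row_mx.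
apply/matrixP => a i; rewrite !mxE; congr (_ + _ + _ + _ + _).
by rewrite follower_row_mx.
Qed.

Lemma mean_field_drift S U : mean_field (drift S U) =
  (mA m + mD m) *m mean_field S + mB m *m mean_field U + mE m *m leader S.
Proof.
rewrite {1}/mean_field /drift; under eq_bigr do rewrite follower_row_mx.
rewrite !big_split /= !scalerDr !mean_const// -!mulmx_sumr !scalemxAr.
rewrite -/(mean_field S) -/(mean_field U) mulmxDl.
by congr (_ + _); rewrite addrAC.
Qed.

(** The terms in D and E are common to all followers and cancel against their own average. *)
Lemma deviation_drift S U i :
  deviation (drift S U) i = mA m *m deviation S i + mB m *m deviation U i.
Proof.
rewrite {1}/deviation mean_field_drift follower_row_mx /deviation !mulmxBr mulmxDl.
apply/matrixP => a b; rewrite !mxE; ring.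
Qed.

Lemma aggregate_drift S U :
  aggregate (drift S U) = Abar m *m aggregate S + Bbar m *m aggregate U.
Proof.
rewrite /aggregate mean_field_drift leader_row_mx /Abar /Bbar !mul_block_col.
rewrite !mul0mx add0r addr0 add_col_mx; congr col_mx; first by rewrite addrAC.
by rewrite addrC addrA.
Qed.

Lemma qform_Qbar (x y : 'cV[R]_dx) : qform (Qbar m) (col_mx x y) =
  qform (mQ0 m) x + qform (mP m) (y - x) + qform (mQ m) y.
Proof.
rewrite /Qbar qform_block !qformDm !mulmxN !mulNmx (qformD _ _ P_sym) qformN bformNr.
have -> : (- (x^T *m mP m *m y)) 0 0 = - bform (mP m) y x.
  by rewrite mxE -/(bform _ _ _) (bformC _ _ P_sym).
have -> : (- (y^T *m mP m *m x)) 0 0 = - bform (mP m) y x by rewrite mxE.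
by ring.
Qed.

Lemma qform_Rbar (x y : 'cV[R]_du) :
  qform (Rbar m) (col_mx x y) = qform (mR0 m) x + qform (mR m) y.
Proof. exact: qform_block_diag. Qed.

(** The parallel axis identity is applied to Q and R around 0 and to P around the leader, while H
    sees deviations only. The remainders at the mean field assemble into [Qbar] and [Rbar]. *)
Lemma stage_cost_joint g t S :
  stage_cost m g t S = joint_form (mQ m + mP m + mH m) (Qbar m) S
    + joint_form (mR m) (Rbar m) (joint_action g t S).
Proof.
set U := joint_action g t S.
have uL : leader_action g t S = leader U by rewrite leader_row_mx.
have uF i : follower_action g t S i = follower U i by rewrite follower_row_mx.
have mean_qform0 d' (M : 'M[R]_d') (T : 'M[R]_(d', 1 + n)) : M^T = M ->
    n%:R^-1 * (\sum_(i < n) qform M (follower T i)) =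
    n%:R^-1 * (\sum_(i < n) qform M (deviation T i)) + qform M (mean_field T).
  move=> sM; rewrite -[mean_field T in RHS]subr0 -mean_qform//.
  by under [in RHS]eq_bigr do rewrite subr0.
have eQPH : \sum_(i < n) qform (mQ m + mP m + mH m) (deviation S i) =
    \sum_(i < n) qform (mQ m) (deviation S i)
    + \sum_(i < n) qform (mP m) (deviation S i)
    + \sum_(i < n) qform (mH m) (deviation S i).
  by rewrite -!big_split; apply: eq_bigr => i _; rewrite !qformDm.
rewrite /stage_cost (pairwise_qform n_gt0 S H_sym) uL.
under eq_bigr do rewrite uF.
rewrite !big_split /= !mulrDr (mean_qform0 _ _ S Q_sym) (mean_qform0 _ _ U R_sym).
rewrite (mean_qform n_gt0 S (leader S) P_sym) /joint_form eQPH.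
by rewrite /aggregate qform_Qbar qform_Rbar; ring.
Qed.

(** On averaging the follower law, [Lb] cancels and the lower block row of [Lbar] remains; the
    strategy thus feeds back on deviations and on the aggregate separately. *)
Lemma joint_action_linear Lb Lbar t S :
  let U := joint_action (linear_strategy n Lb Lbar) t S in
  (forall i, deviation U i = Lb *m deviation S i) /\ aggregate U = Lbar *m aggregate S.
Proof.
move=> U.
have fU i : follower U i = Lb *m follower S i + dlsubmx Lbar *m leader S
    + (drsubmx Lbar - Lb) *m mean_field S by exact: follower_row_mx.
have mU : mean_field U = dlsubmx Lbar *m leader S + drsubmx Lbar *m mean_field S.
  rewrite {1}/mean_field; under eq_bigr do rewrite fU.
  rewrite !big_split /= !scalerDr !mean_const// -mulmx_sumr scalemxAr mulmxBl.
  by rewrite -/(mean_field S) addrC addrA subrK addrC.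
split=> [i|].
  rewrite /deviation fU mU mulmxBl mulmxBr.
  by apply/matrixP => a b; rewrite !mxE; ring.
by rewrite /aggregate mU leader_row_mx -[in RHS](submxK Lbar) mul_block_col.
Qed.

End joint_dynamics.

(** * The Bellman recursion for the joint form *)

Section joint_dynamic_programming.
Context (R : realType) (dx du n : nat) (n_gt0 : (0 < n)%N).
Context (m : lf_model R dx du) (beta : R) (beta_gt0 : 0 < beta).
Context (V : 'M[R]_dx) (W : 'M[R]_du) (Vb : 'M[R]_(dx + dx)) (Wb : 'M[R]_(du + du)).
Hypotheses (pdW : pd W) (pdWb : pd Wb).
Implicit Types (S : 'M[R]_(dx, 1 + n)) (U : 'M[R]_(du, 1 + n)).

Local Notation T := (riccati_op beta (mA m) (mB m) V W).
Local Notation Tb := (riccati_op beta (Abar m) (Bbar m) Vb Wb).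

Lemma joint_cost_to_go M N S U :
  joint_form V Vb S + joint_form W Wb U + beta * joint_form M N (drift m S U) =
  n%:R^-1 * (\sum_(i < n) (qform V (deviation S i) + qform W (deviation U i)
    + beta * qform M (mA m *m deviation S i + mB m *m deviation U i)))
  + (qform Vb (aggregate S) + qform Wb (aggregate U)
    + beta * qform N (Abar m *m aggregate S + Bbar m *m aggregate U)).
Proof.
rewrite /joint_form aggregate_drift//.
have -> : \sum_(i < n) qform M (deviation (drift m S U) i) =
    \sum_(i < n) qform M (mA m *m deviation S i + mB m *m deviation U i).
  by apply: eq_bigr => i _; rewrite deviation_drift.
rewrite !big_split /= -mulr_sumr; ring.
Qed.

Lemma joint_riccati_min M N S U : psd M -> psd N ->
  joint_form (T M) (Tb N) S <=
  joint_form V Vb S + joint_form W Wb U + beta * joint_form M N (drift m S U).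
Proof.
move=> pM pN; rewrite joint_cost_to_go lerD//; last exact: riccati_op_min.
rewrite ler_wpM2l ?invr_ge0//; apply: ler_sum => i _.
exact: riccati_op_min.
Qed.

(** The lower bound of [joint_riccati_min] is attained when each deviation and the aggregate use
    their own Riccati gains. *)
Lemma joint_riccatiE M N S U : psd M -> psd N ->
  (forall i, deviation U i = riccati_gain beta (mA m) (mB m) W M *m deviation S i) ->
  aggregate U = riccati_gain beta (Abar m) (Bbar m) Wb N *m aggregate S ->
  joint_form (T M) (Tb N) S =
  joint_form V Vb S + joint_form W Wb U + beta * joint_form M N (drift m S U).
Proof.
move=> pM pN dU aU; rewrite joint_cost_to_go aU /joint_form riccati_opE//.
congr (_ * _ + _); apply: eq_bigr => i _.
by rewrite dU riccati_opE.
Qed.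

Lemma joint_form_le M M' N N' S : (forall x, qform M x <= qform M' x) ->
  (forall x, qform N x <= qform N' x) -> joint_form M N S <= joint_form M' N' S.
Proof.
move=> leM leN; rewrite lerD// ler_wpM2l ?invr_ge0//.
by apply: ler_sum => i _.
Qed.

Lemma joint_form_cvg (Mk : nat -> 'M[R]_dx) (Nk : nat -> 'M[R]_(dx + dx)) M N S :
  (forall x, (fun t => qform (Mk t) x) @ \oo --> qform M x) ->
  (forall x, (fun t => qform (Nk t) x) @ \oo --> qform N x) ->
  (fun t => joint_form (Mk t) (Nk t) S) @ \oo --> joint_form M N S.
Proof.
move=> cM cN; apply: cvgD => //; apply: cvgM; first exact: cvg_cst.
by apply: cvg_sum => i.
Qed.

End joint_dynamic_programming.

(** * Measurability, independence and expectations *)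

Section matrix_measurability.
Context (R : realType) d (T : measurableType d).

Lemma measurable_entry m n (i : 'I_m) (j : 'I_n) :
  measurable_fun setT (fun M : 'M[R]_(m, n) => M i j).
Proof.
move=> _ B mB; rewrite setTI; apply: sub_sigma_algebra.
by exists i, j, B.
Qed.

Lemma measurable_mxP m n (f : T -> 'M[R]_(m, n)) :
  measurable_fun setT f <-> forall i j, measurable_fun setT (fun x => f x i j).
Proof.
split=> [mf i j|mf]; first exact: measurableT_comp (measurable_entry i j) mf.
apply: (measurability (matrix_cylinder (R := R) (m := m) (n := n))) => //.
move=> _ [_ [i [j [B [mB ->]]]] <-].
exact: mf.
Qed.

Lemma measurable_mulmx m n p (A : 'M[R]_(m, n)) (f : T -> 'M[R]_(n, p)) :
  measurable_fun setT f -> measurable_fun setT (fun x => A *m f x).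
Proof.
move=> /measurable_mxP mf; apply/measurable_mxP => i j.
under eq_fun do rewrite mxE.
by apply: measurable_sum => k; apply: measurable_funM.
Qed.

Lemma measurable_addmx m n (f g : T -> 'M[R]_(m, n)) :
  measurable_fun setT f -> measurable_fun setT g ->
  measurable_fun setT (fun x => f x + g x).
Proof.
move=> /measurable_mxP mf /measurable_mxP mg; apply/measurable_mxP => i j.
under eq_fun do rewrite mxE.
exact: measurable_funD.
Qed.

Lemma measurable_scalemx m n a (f : T -> 'M[R]_(m, n)) :
  measurable_fun setT f -> measurable_fun setT (fun x => a *: f x).
Proof.
move=> /measurable_mxP mf; apply/measurable_mxP => i j.
under eq_fun do rewrite mxE.
exact: measurable_funM.
Qed.

Lemma measurable_row_mx m n p (f : T -> 'M[R]_(m, n)) (g : T -> 'M[R]_(m, p)) :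
  measurable_fun setT f -> measurable_fun setT g ->
  measurable_fun setT (fun x => row_mx (f x) (g x)).
Proof.
move=> /measurable_mxP mf /measurable_mxP mg; apply/measurable_mxP => i j.
under eq_fun do rewrite mxE.
by case: (fintype.split j) => k; [exact: mf|exact: mg].
Qed.

Lemma measurable_col_mx m n p (f : T -> 'M[R]_(m, p)) (g : T -> 'M[R]_(n, p)) :
  measurable_fun setT f -> measurable_fun setT g ->
  measurable_fun setT (fun x => col_mx (f x) (g x)).
Proof.
move=> /measurable_mxP mf /measurable_mxP mg; apply/measurable_mxP => i j.
under eq_fun do rewrite mxE.
by case: (fintype.split i) => k; [exact: mf|exact: mg].
Qed.

Lemma measurable_columns m n (f : T -> 'I_n -> 'cV[R]_m) :
  (forall j, measurable_fun setT (f ^~ j)) ->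
  measurable_fun setT (fun x => \matrix_(i < m, j < n) f x j i 0).
Proof.
move=> mf; apply/measurable_mxP => i j; under eq_fun do rewrite mxE.
by have /measurable_mxP := mf j; apply.
Qed.

Lemma measurable_qform m (M : 'M[R]_m) (f : T -> 'cV[R]_m) :
  measurable_fun setT f -> measurable_fun setT (fun x => qform M (f x)).
Proof.
move=> /measurable_mxP mf; under eq_fun do rewrite qform_sum.
apply: measurable_sum => i; apply: measurable_sum => j.
by apply: measurable_funM => //; exact: measurable_funM.
Qed.

Section joint.
Context (m n : nat) (f : T -> 'M[R]_(m, 1 + n)) (mf : measurable_fun setT f).

Lemma measurable_leader : measurable_fun setT (fun x => leader (f x)).
Proof.
apply/measurable_mxP => i j; under eq_fun do rewrite mxE.
by have /measurable_mxP := mf; apply.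
Qed.

Lemma measurable_follower i : measurable_fun setT (fun x => follower (f x) i).
Proof.
apply/measurable_mxP => a b; under eq_fun do rewrite !mxE.
by have /measurable_mxP := mf; apply.
Qed.

Lemma measurable_mean_field : measurable_fun setT (fun x => mean_field (f x)).
Proof.
apply: measurable_scalemx; apply/measurable_mxP => a b.
under eq_fun do rewrite summxE.
apply: measurable_sum => i.
by have /measurable_mxP := measurable_follower i; apply.
Qed.

Lemma measurable_joint_form M N :
  measurable_fun setT (fun x => joint_form M N (f x)).
Proof.
apply: measurable_funD.
  apply: measurable_funM => //; apply: measurable_sum => i.
  apply: measurable_qform; under eq_fun do rewrite /deviation -scaleN1r.
  apply: measurable_addmx; first exact: measurable_follower.
  exact/measurable_scalemx/measurable_mean_field.
apply: measurable_qform; apply: measurable_col_mx; first exact: measurable_leader.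
exact: measurable_mean_field.
Qed.

End joint.

End matrix_measurability.

Section strategies.
Context (R : realType) (dx du n : nat) (m : lf_model R dx du).

Lemma measurable_joint_action (g : strategy R dx du n) t : admissible g ->
  measurable_fun setT (joint_action g t).
Proof.
move=> [mg0 mg]; apply: measurable_row_mx.
  apply: (measurableT_comp (mg0 t) (measurable_fun_pair (measurable_leader _)
    (measurable_mean_field _))); exact: measurable_id.
apply: measurable_columns => i.
apply: (measurableT_comp (mg t i) (measurable_fun_pair (measurable_fun_pair
  (measurable_follower _ i) (measurable_mean_field _)) (measurable_leader _)));
  exact: measurable_id.
Qed.

Lemma measurable_drift d (T : measurableType d) (S : T -> 'M[R]_(dx, 1 + n))
    (U : T -> 'M[R]_(du, 1 + n)) :
  measurable_fun setT S -> measurable_fun setT U ->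
  measurable_fun setT (fun x => drift m (S x) (U x)).
Proof.
move=> mS mU; apply: measurable_row_mx.
  apply: measurable_addmx; last exact/measurable_mulmx/measurable_mean_field.
  apply: measurable_addmx; exact/measurable_mulmx/measurable_leader.
apply: measurable_columns => i.
apply: measurable_addmx; last exact/measurable_mulmx/measurable_leader.
apply: measurable_addmx; last exact/measurable_mulmx/measurable_mean_field.
apply: measurable_addmx; exact/measurable_mulmx/measurable_follower.
Qed.

Lemma linear_strategy_admissible (Lb : 'M[R]_(du, dx)) (Lbar : 'M[R]_(du + du, dx + dx)) :
  admissible (linear_strategy n Lb Lbar).
Proof.
split=> [t|t i] /=.
  by apply: measurable_addmx; apply: measurable_mulmx;
    [exact: measurable_fst|exact: measurable_snd].
apply: measurable_addmx; last first.
  apply: measurable_mulmx; exact: measurableT_comp measurable_snd measurable_fst.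
apply: measurable_addmx; apply: measurable_mulmx; last exact: measurable_snd.
exact: measurableT_comp measurable_fst measurable_fst.
Qed.

End strategies.

(** * Independence and Tonelli *)

Section independence.
Local Open Scope ereal_scope.
Context (R : realType) d d1 d2 (Omega : measurableType d)
  (T1 : measurableType d1) (T2 : measurableType d2) (P : probability Omega R).
Context (X : {mfun Omega >-> T1}) (Y : {mfun Omega >-> T2}).

(** Both sides are finite measures in C, and they agree on the rectangles, a generating class stable
    under intersection. *)
Lemma joint_independent_event (E : set Omega) : measurable E ->
  (forall A B, measurable A -> measurable B ->
     P (X @^-1` A `&` Y @^-1` B `&` E) = P (X @^-1` A `&` Y @^-1` B) * P E) ->
  forall C : set (T1 * T2), measurable C ->
    P ((fun w => (X w, Y w)) @^-1` C `&` E) =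
    P ((fun w => (X w, Y w)) @^-1` C) * P E.
Proof.
move=> mE indE C mC.
have mXY : measurable_fun setT (fun w => (X w, Y w)) by exact: measurable_fun_pair.
pose XY : {mfun Omega >-> (T1 * T2)%type} :=
  HB.pack (fun w => (X w, Y w)) (isMeasurableFun.Build _ _ _ _ _ mXY).
have pE0 : (0 <= fine (P E))%R by exact/fine_ge0/measure_ge0.
pose m1 := pushforward (mrestr P mE) XY.
pose m2 := mscale (NngNum pE0) (distribution P XY).
have fE : P E = (fine (P E))%:E by rewrite fineK// fin_num_measure.
suff : m1 C = m2 C.
  by rewrite /m1 /m2 /mscale /mrestr /distribution /pushforward /= -fE muleC.
pose G : set (set (T1 * T2)) := [set A `*` B | A in measurable & B in measurable].
apply: (measure_unique G (fun=> setT)) => //.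
- exact: measurable_prod_measurableType.
- move=> _ _ [A mA [B mB <-]] [A' mA' [B' mB' <-]]; rewrite -setXI.
  by exists (A `&` A'); [exact: measurableI|exists (B `&` B'); [exact: measurableI|]].
- by move=> _; exists setT => //; exists setT => //; rewrite setXTT.
- by rewrite bigcup_const.
- move=> _ [A mA [B mB <-]].
  change (P (X @^-1` A `&` Y @^-1` B `&` E) =
    (fine (P E))%:E * P (X @^-1` A `&` Y @^-1` B)).
  by rewrite -fE muleC indE.
- move=> _; apply: le_lt_trans (ltry 1); apply: probability_le1.
  by rewrite setTI.
Qed.

(** Independence makes the law of (X, Y) a product measure; nonnegativity of f then allows iterated
    integration without integrability. *)
Lemma expectation_tonelli (f : T1 * T2 -> \bar R) :
  (forall A B, measurable A -> measurable B ->
     P (X @^-1` A `&` Y @^-1` B) = P (X @^-1` A) * P (Y @^-1` B)) ->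
  measurable_fun setT f -> (forall z, 0 <= f z) ->
  \int[P]_w f (X w, Y w) = \int[P]_w \int[P]_w' f (X w, Y w').
Proof.
move=> ind mf f0.
have mXY : measurable_fun setT (fun w => (X w, Y w)) by exact: measurable_fun_pair.
pose XY : {mfun Omega >-> (T1 * T2)%type} :=
  HB.pack (fun w => (X w, Y w)) (isMeasurableFun.Build _ _ _ _ _ mXY).
transitivity (\int[distribution P XY]_z f z).
  by rewrite ge0_integral_pushforward.
have -> : \int[distribution P XY]_z f z =
    \int[distribution P X \x distribution P Y]_z f z.
  apply: eq_measure_integral => C mC _; apply/esym.
  exact: product_measure_unique.
rewrite fubini_tonelli1// ge0_integral_pushforward//; last 2 first.
- exact: measurable_fun_fubini_tonelli_F.
- by move=> x _; exact: integral_ge0.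
apply: eq_integral => w _ /=; rewrite /fubini_F ge0_integral_pushforward//.
by apply: measurableT_comp => //; exact: pair1_measurable.
Qed.

End independence.

(** * Expectation of the joint form under centred noise *)

Section expectation_of_quadratic_forms.
Local Open Scope ereal_scope.
Context (R : realType) d (Omega : measurableType d) (P : probability Omega R).
Context (p n : nat) (M : 'M[R]_p) (N : 'M[R]_(p + p)).
Hypotheses (psdM : psd M) (psdN : psd N).
Local Notation q := (joint_form M N).

(** A linear functional is a finite combination of entries, each integrable with mean zero. *)
Lemma zero_mean_linear (k l : nat) (f : 'M[R]_(k, l) -> R)
    (Z : Omega -> 'M[R]_(k, l)) :
  (forall a Y Y', f (a *: Y + Y') = a * f Y + f Y')%R -> zero_mean P Z ->
  P.-integrable setT (fun w => (f (Z w))%:E) /\ \int[P]_w (f (Z w))%:E = 0.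
Proof.
move=> lin Z0.
have f0 : f 0%R = 0%R.
  have := lin 1%R 0%R 0%R; rewrite scale1r add0r mul1r => /esym/eqP.
  by rewrite -subr_eq0 addrK => /eqP.
have fD Y Y' : (f (Y + Y') = f Y + f Y')%R.
  by have := lin 1%R Y Y'; rewrite scale1r mul1r.
have fZ a Y : (f (a *: Y) = a * f Y)%R by rewrite -[(a *: Y)%R]addr0 lin f0 addr0.
have fE : (fun w => (f (Z w))%:E) = (fun w => \sum_i \sum_j
    (f (delta_mx i j))%:E * (Z w i j)%:E).
  apply/funext => w; rewrite [in LHS](matrix_sum_delta (Z w)).
  rewrite (big_morph f fD f0) -sumEFin; apply: eq_bigr => i _.
  rewrite (big_morph f fD f0) -sumEFin; apply: eq_bigr => j _.
  by rewrite fZ EFinM muleC.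
have intZ i j : P.-integrable setT (fun w => (f (delta_mx i j))%:E * (Z w i j)%:E).
  by apply: integrableZl => //; have [] := Z0 i j.
rewrite fE; split; first by apply: integrable_sum => // i _; exact: integrable_sum.
rewrite integral_sum// => [|i]; last exact: integrable_sum.
rewrite big1// => i _; rewrite integral_sum// big1// => j _.
by have [iZ eZ] := Z0 i j; rewrite integralZl// eZ mule0.
Qed.

(** Write Z = (Y + Z) - Y and drop the nonnegative term q(Y + Z + Y) from the parallelogram law. *)
Lemma joint_form_parallelogram (Y Z : 'M[R]_(p, 1 + n)) :
  (q Z <= 2 * q (Y + Z) + 2 * q Y)%R.
Proof.
have [sM _] := psdM; have [sN _] := psdN.
have := joint_form_ge0 (Y + Z + Y) psdM psdN.
rewrite -[q Z](_ : q (Y + Z - Y)%R = _)%R; last by rewrite addrAC subrr add0r.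
rewrite [X in (_ -> X <= _)%R](joint_formD _ _ sM sN) (joint_formD (Y + Z) Y sM sN).
rewrite joint_formN.
rewrite joint_bformNr.
by lra.
Qed.

(** When E q(Z) is finite, q(y + Z) may be expanded and integrated term by term, and the cross term
    has mean zero. Otherwise both sides are infinite. *)
Lemma expectation_translate (y : 'M[R]_(p, 1 + n)) (Z : Omega -> 'M[R]_(p, 1 + n)) :
  measurable_fun setT Z -> zero_mean P Z ->
  \int[P]_w (q (y + Z w))%:E = (q y)%:E + \int[P]_w (q (Z w))%:E.
Proof.
move=> mZ Z0.
have mq : measurable_fun setT (fun w => (q (Z w))%:E).
  exact/measurable_EFinP/measurable_joint_form.
have mqy : measurable_fun setT (fun w => (q (y + Z w))%:E).
  apply/measurable_EFinP/measurable_joint_form/measurable_addmx => //.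
have q0 Y : 0 <= (q Y)%:E by rewrite lee_fin joint_form_ge0.
have qy0 : 0 <= \int[P]_w (q (y + Z w))%:E by exact: integral_ge0.
(* If E q(Z) is infinite, so is E q(y + Z) by the parallelogram bound. *)
have [qoo|qfin] := eqVneq (\int[P]_w (q (Z w))%:E) +oo.
  have : \int[P]_w (q (Z w))%:E <=
      2%:E * (\int[P]_w (q (y + Z w))%:E) + (2 * q y)%:E.
    have -> : (2 * q y)%:E = \int[P]_w (cst (2 * q y)%:E w).
      by rewrite integral_cst//= probability_setT mule1.
    have qy2 : 0 <= (2 * q y)%:E by rewrite lee_fin mulr_ge0// joint_form_ge0.
    rewrite -ge0_integralZl// -ge0_integralD//; last 2 first.
    - by move=> w _; exact: mule_ge0.
    - exact: measurable_funeM.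
    apply: ge0_le_integral => //.
      apply: emeasurable_funD => //; exact: measurable_funeM.
    by move=> w _; rewrite -EFinM -EFinD lee_fin joint_form_parallelogram.
  move: (\int[P]_w (q (Z w))%:E) (\int[P]_w (q (y + Z w))%:E) qoo qy0.
  by move=> _ [r| |] -> // _; rewrite -EFinM -EFinD leye_eq.
have intq : P.-integrable setT (fun w => (q (Z w))%:E).
  apply/integrableP; split=> //.
  under eq_integral do rewrite gee0_abs//.
  by rewrite ltey.
have [intb b0] := zero_mean_linear (joint_bform_linear M N y) Z0.
have -> : (fun w => (q (y + Z w))%:E) = (fun w => cst (q y)%:E w
    + (2%:E * (joint_bform M N y (Z w))%:E + (q (Z w))%:E)).
  apply/funext => w; rewrite /= -EFinM -!EFinD.
  by rewrite (joint_formD _ _ psdM.1 psdN.1) -addrA.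
have int2b : P.-integrable setT (fun w => 2%:E * (joint_bform M N y (Z w))%:E).
  exact: integrableZl.
have intc : P.-integrable setT (cst (q y)%:E : Omega -> \bar R).
  apply/integrableP; split; first exact: measurable_cst.
  by rewrite integral_cst//= probability_setT mule1 ltry.
rewrite integralD//; last exact: integrableD.
rewrite integralD// integralZl// b0 mule0 add0e.
by rewrite integral_cst//= probability_setT mule1.
Qed.

(** By Tonelli, X is frozen in the inner integral, where the translation identity applies. *)
Lemma expectation_independent_sum d1 (T1 : measurableType d1) (X : {mfun Omega >-> T1})
    (Z : {mfun Omega >-> 'M[R]_(p, 1 + n)}) (phi : T1 -> 'M[R]_(p, 1 + n)) :
  (forall A B, measurable A -> measurable B ->
     P (X @^-1` A `&` Z @^-1` B) = P (X @^-1` A) * P (Z @^-1` B)) ->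
  zero_mean P Z -> measurable_fun setT phi ->
  \int[P]_w (q (phi (X w) + Z w))%:E =
  \int[P]_w (q (phi (X w)))%:E + \int[P]_w (q (Z w))%:E.
Proof.
move=> ind Z0 mphi.
have q0 Y : 0 <= (q Y)%:E by rewrite lee_fin joint_form_ge0.
pose f (z : T1 * 'M[R]_(p, 1 + n)) := (q (phi z.1 + z.2))%:E.
have mf : measurable_fun setT f.
  apply/measurable_EFinP/measurable_joint_form/measurable_addmx => //.
  exact: measurableT_comp mphi measurable_fst.
have f0 z : 0 <= f z by exact: q0.
rewrite [LHS](expectation_tonelli ind mf f0).
rewrite /f /=; under eq_integral do rewrite expectation_translate//.
rewrite ge0_integralD//.
- by rewrite integral_cst//= probability_setT mule1.
- apply/measurable_EFinP/measurable_joint_form.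
  exact: measurableT_comp.
- by move=> *; exact: integral_ge0.
Qed.

End expectation_of_quadratic_forms.

(** * The state is independent of present and future noise *)

Section state_process.
Local Open Scope ereal_scope.
Context (R : realType) d (Omega : measurableType d) (P : probability Omega R).

Lemma mutually_independent_cons d' (T : measurableType d')
    (Y : nat -> Omega -> T) k (s : seq nat) (B : nat -> set T) :
  mutually_independent P Y -> uniq (k :: s) -> (forall j, measurable (B j)) ->
  P (Y k @^-1` B k `&` \big[setI/setT]_(j <- s) (Y j @^-1` B j)) =
  P (Y k @^-1` B k) * P (\big[setI/setT]_(j <- s) (Y j @^-1` B j)).
Proof.
move=> ind us mB; have /andP[_ us'] := us.
have := ind _ _ us mB; rewrite !big_cons => ->.
have := ind [:: k] B isT mB; rewrite !big_seq1 => ->.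
by rewrite (ind s B us' mB) EFinM.
Qed.

Context (dx du n : nat) (m : lf_model R dx du).
Context (X1 : Omega -> 'M[R]_(dx, 1 + n)) (W : nat -> Omega -> 'M[R]_(dx, 1 + n)).
Hypotheses (X1_meas : measurable_fun setT X1)
  (W_meas : forall t, measurable_fun setT (W t))
  (indep : independent_in_time P X1 W).
Context (g : strategy R dx du n) (admg : admissible g).

Local Notation S := (state m g X1 W).

Definition next_drift t (s : 'M[R]_(dx, 1 + n)) := drift m s (joint_action g t s).

Lemma measurable_next_drift t : measurable_fun setT (next_drift t).
Proof.
apply: measurable_drift; first exact: measurable_id.
exact: measurable_joint_action.
Qed.

Lemma stateS t w : S t.+1 w = (next_drift t (S t w) + W t w)%R.
Proof. by rewrite /= step_drift. Qed.

Lemma measurable_state t : measurable_fun setT (S t).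
Proof.
elim: t => [//|t IH].
rewrite (_ : S t.+1 = fun w => (next_drift t (S t w) + W t w)%R); last first.
  by apply/funext => w; rewrite stateS.
apply: measurable_addmx => //.
exact: measurableT_comp (measurable_next_drift t) IH.
Qed.

Definition state_mfun t : {mfun Omega >-> 'M[R]_(dx, 1 + n)} :=
  HB.pack (S t) (isMeasurableFun.Build _ _ _ _ _ (measurable_state t)).

Definition noise_mfun t : {mfun Omega >-> 'M[R]_(dx, 1 + n)} :=
  HB.pack (W t) (isMeasurableFun.Build _ _ _ _ _ (W_meas t)).

Lemma noise_independent t (s : seq nat) (B : nat -> set 'M[R]_(dx, 1 + n)) :
  uniq (t :: s) -> (forall j, measurable (B j)) ->
  P (W t @^-1` B t `&` \big[setI/setT]_(j <- s) (W j @^-1` B j)) =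
  P (W t @^-1` B t) * P (\big[setI/setT]_(j <- s) (W j @^-1` B j)).
Proof.
move=> us mB.
(* Index 0 of the independent family is the initial state, so [W t] has index t + 1. *)
have := @mutually_independent_cons _ _ _ t.+1 (map Datatypes.S s) (fun j => B j.-1) indep.
rewrite !big_map /=; apply => //.
by rewrite (mem_map succn_inj) (map_inj_uniq succn_inj).
Qed.

(** Induction on t for a whole list of later noises: the state at t + 1 is a function of the state
    and the noise at t, so the hypothesis is used with t added to the list, first on rectangles and
    then on all measurable sets. *)
Lemma state_future_independent t (s : seq nat) (A : set 'M[R]_(dx, 1 + n))
    (B : nat -> set 'M[R]_(dx, 1 + n)) :
  uniq s -> all (leq t) s -> measurable A -> (forall j, measurable (B j)) ->
  P (S t @^-1` A `&` \big[setI/setT]_(j <- s) (W j @^-1` B j)) =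
  P (S t @^-1` A) * P (\big[setI/setT]_(j <- s) (W j @^-1` B j)).
Proof.
elim: t s A B => [|t IH] s A B us ts mA mB.
  have := @mutually_independent_cons _ _ _ 0%N (map Datatypes.S s)
    (fun j => if j is i.+1 then B i else A) indep.
  rewrite !big_map /=; apply; last by case.
  rewrite (map_inj_uniq succn_inj) us andbT.
  by apply/mapP => -[].
set E := \big[_/_]_(_ <- _) _.
have mE : measurable E.
  apply: bigsetI_measurable => j _; rewrite -[X in measurable X]setTI.
  exact: W_meas.
pose F (z : 'M[R]_(dx, 1 + n) * 'M[R]_(dx, 1 + n)) := (next_drift t z.1 + z.2)%R.
have mF : measurable_fun setT F.
  apply: measurable_addmx; last exact: measurable_snd.
  exact: measurableT_comp (measurable_next_drift t) measurable_fst.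
have mFA : measurable (F @^-1` A) by rewrite -[X in measurable X]setTI; exact: mF.
have SE : S t.+1 @^-1` A = (fun w => (S t w, W t w)) @^-1` (F @^-1` A).
  by apply/funext => w; rewrite /preimage /= step_drift.
have tNs : t \notin s.
  by apply/negP => /(allP ts); rewrite ltnn.
have ts' : all (leq t) s.
  by apply/allP => j /(allP ts); exact: ltnW.
rewrite SE.
apply: (@joint_independent_event _ _ _ _ _ _ _ P (state_mfun t) (noise_mfun t)) => //.
move=> A' B' mA' mB'.
(* As t is not in s, altering B at t leaves the event E unchanged. *)
pose B'' j := if j == t then B' else B j.
have mB'' j : measurable (B'' j) by rewrite /B''; case: ifP.
have EE : E = \big[setI/setT]_(j <- s) (W j @^-1` B'' j).
  apply: eq_big_seq => j js; rewrite /B''; case: eqP => // jt.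
  by move: tNs; rewrite -jt js.
have Bt : B'' t = B' by rewrite /B'' eqxx.
have uts : uniq (t :: s) by rewrite /= tNs.
have := IH (t :: s) A' B'' uts _ mA' mB''; rewrite /= leqnn ts' => /(_ isT).
rewrite big_cons Bt -EE setIA => ->.
have := IH [:: t] A' B'' isT _ mA' mB''; rewrite /= leqnn => /(_ isT).
rewrite big_seq1 Bt => ->.
have := noise_independent uts mB''; rewrite Bt -EE => ->.
by rewrite muleA.
Qed.

Lemma state_noise_independent t (A B : set 'M[R]_(dx, 1 + n)) :
  measurable A -> measurable B ->
  P (S t @^-1` A `&` W t @^-1` B) = P (S t @^-1` A) * P (W t @^-1` B).
Proof.
move=> mA mB; have := @state_future_independent t [:: t] A (fun=> B).
by rewrite !big_seq1 /= leqnn; apply.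
Qed.

Hypothesis W_mean : forall t, zero_mean P (W t).

Lemma expectation_next_state M N t : psd M -> psd N ->
  \int[P]_w (joint_form M N (S t.+1 w))%:E =
  \int[P]_w (joint_form M N (next_drift t (S t w)))%:E
    + \int[P]_w (joint_form M N (W t w))%:E.
Proof.
move=> pM pN; under eq_integral do rewrite stateS.
apply: (@expectation_independent_sum _ _ _ P _ _ M N pM pN _ _ (state_mfun t)
  (noise_mfun t) (next_drift t)).
- exact: state_noise_independent.
- exact: W_mean.
- exact: measurable_next_drift.
Qed.

End state_process.

(** * Optimality *)

Section discounted_sums.
Local Open Scope ereal_scope.
Context (R : realType) (beta : R) (beta_ge0 : (0 <= beta)%R).
Implicit Types a : nat -> \bar R.

(** The cost of K stages from time t on, discounted relative to t. The Horner form suits backward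
    induction. *)
Fixpoint discounted_sum a (K t : nat) : \bar R :=
  if K is K'.+1 then a t + beta%:E * discounted_sum a K' t.+1 else 0.

Lemma discounted_sum_ge0 a K t : (forall s, 0 <= a s) -> 0 <= discounted_sum a K t.
Proof.
by move=> a0; elim: K t => //= K IH t; rewrite adde_ge0// mule_ge0// lee_fin.
Qed.

Lemma discounted_sumE a K t : (forall s, 0 <= a s) ->
  discounted_sum a K t = \sum_(0 <= j < K) (beta ^+ j)%:E * a (t + j)%N.
Proof.
move=> a0; elim: K t => [|K IH] t /=; first by rewrite big_nil.
rewrite big_nat_recl//= mul1e addn0 IH; congr (_ + _).
rewrite ge0_sume_distrr => [|j _]; last by rewrite mule_ge0// lee_fin exprn_ge0.
by apply: eq_bigr => j _; rewrite muleA -EFinM -exprS addSnnS.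
Qed.

Lemma discounted_sum_cvg (a : nat -> nat -> \bar R) l K t :
  (forall k s, 0 <= a k s) -> (forall s, a ^~ s @ \oo --> l s) ->
  (fun k => discounted_sum (a k) K t) @ \oo --> discounted_sum l K t.
Proof.
move=> a0 al; have l0 s : 0 <= l s.
  by apply: (cvge_to_ge (al s)); exact: nearW.
elim: K t => [|K IH] t /=; first exact: cvg_cst.
apply: cvgeD => //; last exact: cvgeZl.
by rewrite ge0_adde_def// inE// mule_ge0 ?lee_fin// discounted_sum_ge0.
Qed.

End discounted_sums.

Section optimality.
Local Open Scope ereal_scope.
Context (R : realType) (n dx du : nat) (n_gt0 : (0 < n)%N).
Context (beta : R) (beta_gt0 : (0 < beta)%R) (m : lf_model R dx du).
Hypotheses (Q_sym : ((mQ m)^T = mQ m)%R) (P_sym : ((mP m)^T = mP m)%R)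
  (R_sym : ((mR m)^T = mR m)%R) (H_sym : ((mH m)^T = mH m)%R).
Context (d : measure_display) (Omega : measurableType d) (Pr : probability Omega R).
Context (X1 : Omega -> 'M[R]_(dx, 1 + n)) (W : nat -> Omega -> 'M[R]_(dx, 1 + n)).
Hypotheses (X1_meas : measurable_fun setT X1)
  (W_meas : forall t, measurable_fun setT (W t))
  (W_mean : forall t, zero_mean Pr (W t)) (indep : independent_in_time Pr X1 W).
Hypotheses (QPH_psd : psd (mQ m + mP m + mH m)%R) (Qbar_psd : psd (Qbar m))
  (R_pd : pd (mR m)) (Rbar_pd : pd (Rbar m)).

Local Notation T := (riccati_op beta (mA m) (mB m) (mQ m + mP m + mH m)%R (mR m)).
Local Notation Tb := (riccati_op beta (Abar m) (Bbar m) (Qbar m) (Rbar m)).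
Local Notation Mk := (value_iter beta (mA m) (mB m) (mQ m + mP m + mH m)%R (mR m)).
Local Notation Nk := (value_iter beta (Abar m) (Bbar m) (Qbar m) (Rbar m)).
Local Notation S g := (state m g X1 W).

Let beta_ge0 : (0 <= beta)%R := ltW beta_gt0.
Let betaE_ge0 : 0 <= beta%:E. Proof. by rewrite lee_fin. Qed.

Definition expected_cost (g : strategy R dx du n) t : \bar R :=
  \int[Pr]_w (stage_cost m g t (S g t w))%:E.

Definition state_value g M N t : \bar R := \int[Pr]_w (joint_form M N (S g t w))%:E.
Definition noise_value M N t : \bar R := \int[Pr]_w (joint_form M N (W t w))%:E.

Lemma stage_cost_ge0 (g : strategy R dx du n) t s : (0 <= stage_cost m g t s)%R.
Proof.
rewrite stage_cost_joint// addr_ge0// joint_form_ge0//; exact: pd_psd.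
Qed.

Lemma measurable_stage_cost g t : admissible g ->
  measurable_fun setT (fun w => stage_cost m g t (S g t w)).
Proof.
move=> admg; under eq_fun do rewrite stage_cost_joint//.
have mS := measurable_state m X1_meas W_meas admg t.
apply: measurable_funD; apply: measurable_joint_form => //.
exact: measurableT_comp (measurable_joint_action t admg) mS.
Qed.

Lemma expected_cost_ge0 g t : 0 <= expected_cost g t.
Proof. by apply: integral_ge0 => w _; rewrite lee_fin stage_cost_ge0. Qed.

Lemma joint_value_ge0 M N (Z : Omega -> 'M[R]_(dx, 1 + n)) : psd M -> psd N ->
  0 <= \int[Pr]_w (joint_form M N (Z w))%:E.
Proof.
by move=> pM pN; apply: integral_ge0 => w _; rewrite lee_fin joint_form_ge0.
Qed.

Lemma total_costE g : admissible g -> total_cost Pr beta m g X1 W =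
  \sum_(0 <= t <oo) (beta ^+ t)%:E * expected_cost g t.
Proof.
move=> admg; rewrite /total_cost integral_nneseries//.
- apply: eq_eseriesr => t _; under eq_integral do rewrite EFinM.
  rewrite ge0_integralZl//.
  + exact/measurable_EFinP/measurable_stage_cost.
  + by move=> w _; rewrite lee_fin stage_cost_ge0.
  + by rewrite lee_fin exprn_ge0.
- move=> t; apply/measurable_EFinP/measurable_funM => //.
  exact: measurable_stage_cost.
- by move=> t w _; rewrite lee_fin mulr_ge0 ?exprn_ge0// stage_cost_ge0.
Qed.

(** The noise adds a term that does not depend on the strategy; what remains is a pathwise one-step
    cost along the noise-free drift. *)
Lemma cost_to_goE g M N t : admissible g -> psd M -> psd N ->
  expected_cost g t + beta%:E * state_value g M N t.+1 =
  \int[Pr]_w (stage_cost m g t (S g t w)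
      + beta * joint_form M N (next_drift m g t (S g t w)))%:E
  + beta%:E * noise_value M N t.
Proof.
move=> admg pM pN; have mS := measurable_state m X1_meas W_meas admg t.
have mJ : measurable_fun setT (fun w => joint_form M N (next_drift m g t (S g t w))).
  apply: measurable_joint_form.
  exact: measurableT_comp (measurable_next_drift m admg t) mS.
rewrite /state_value (expectation_next_state m X1_meas W_meas indep admg W_mean)//.
rewrite ge0_muleDr ?joint_value_ge0// addeA; congr (_ + _).
under [in RHS]eq_integral do rewrite EFinD EFinM.
rewrite ge0_integralD//.
- congr (_ + _); rewrite ge0_integralZl//; first exact/measurable_EFinP.
  by move=> w _; rewrite lee_fin joint_form_ge0.
- by move=> w _; rewrite lee_fin stage_cost_ge0.
- exact/measurable_EFinP/measurable_stage_cost.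
- by move=> w _; rewrite mule_ge0// lee_fin joint_form_ge0.
- exact/measurable_funeM/measurable_EFinP.
Qed.

Lemma bellman_le g M N t : admissible g -> psd M -> psd N ->
  state_value g (T M) (Tb N) t + beta%:E * noise_value M N t <=
  expected_cost g t + beta%:E * state_value g M N t.+1.
Proof.
move=> admg pM pN; rewrite cost_to_goE//; apply: leeD2r.
have mS := measurable_state m X1_meas W_meas admg t.
apply: ge0_le_integral => //.
- move=> w _; rewrite lee_fin joint_form_ge0//; exact: riccati_op_psd.
- exact/measurable_EFinP/measurable_joint_form.
- apply/measurable_EFinP/measurable_funD; first exact: measurable_stage_cost.
  apply: measurable_funM => //; apply: measurable_joint_form.
  exact: measurableT_comp (measurable_next_drift m admg t) mS.
- move=> w _; rewrite lee_fin stage_cost_joint//.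
  exact: joint_riccati_min.
Qed.

(** Over the last k stages the iterate index runs down to 0 and the noise terms are dropped. Over
    the first K stages the index stays at k, which is permitted by M_k <= T M_k, and the noise is
    kept. This lets k tend to infinity with K fixed. *)
Lemma value_iter_lower_bound g k K t : admissible g ->
  state_value g (Mk k) (Nk k) t
    + beta%:E * discounted_sum beta (noise_value (Mk k) (Nk k)) K t <=
  discounted_sum beta (expected_cost g) (K + k) t.
Proof.
move=> admg.
have pM j := value_iter_psd beta_gt0 (mA m) (mB m) QPH_psd R_pd j.
have pN j := value_iter_psd beta_gt0 (Abar m) (Bbar m) Qbar_psd Rbar_pd j.
have w0 j s : 0 <= noise_value (Mk j) (Nk j) s by exact: joint_value_ge0.
have v0 j s : 0 <= state_value g (Mk j) (Nk j) s by exact: joint_value_ge0.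
elim: K t => [|K IH] t.
  (* K = 0: the finite-horizon bound, by backward induction on k. *)
  rewrite /= mule0 adde0 add0n; elim: k t => [|k IH] t /=.
    rewrite /state_value integral0_eq// => w _.
    rewrite /joint_form big1 ?mulr0 ?add0r ?qform0m// => i _.
    by rewrite qform0m.
  apply: le_trans (_ : expected_cost g t
      + beta%:E * state_value g (Mk k) (Nk k) t.+1 <= _).
    apply: le_trans (bellman_le t admg (pM k) (pN k)).
    by rewrite leeDl// mule_ge0.
  by rewrite leeD2l// lee_wpmul2l.
have dK0 s : 0 <= beta%:E * discounted_sum beta (noise_value (Mk k) (Nk k)) K s.
  by rewrite mule_ge0// discounted_sum_ge0.
rewrite addSn /= (ge0_muleDr beta%:E (w0 k t) (dK0 t.+1)) addeA.
apply: le_trans (_ : expected_cost g t + beta%:E * (state_value g (Mk k) (Nk k) t.+1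
    + beta%:E * discounted_sum beta (noise_value (Mk k) (Nk k)) K t.+1) <= _); last first.
  by rewrite leeD2l// lee_wpmul2l.
rewrite (ge0_muleDr beta%:E (v0 k t.+1) (dK0 t.+1)) addeA.
apply: leeD2r.
(* The Bellman inequality yields index k + 1, which is lowered to k by monotonicity of the
   iterates. *)
apply: le_trans (bellman_le t admg (pM k) (pN k)); rewrite leeD2r//.
have mS := measurable_state m X1_meas W_meas admg t.
apply: ge0_le_integral => //.
- by move=> w _; rewrite lee_fin joint_form_ge0.
- exact/measurable_EFinP/measurable_joint_form.
- exact/measurable_EFinP/measurable_joint_form.
- move=> w _; rewrite lee_fin; apply: joint_form_le => x.
    exact: (value_iter_nondecreasing beta_gt0 _ _ QPH_psd R_pd x (leqnSn k)).
  exact: (value_iter_nondecreasing beta_gt0 _ _ Qbar_psd Rbar_pd x (leqnSn k)).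
Qed.

(** Monotone convergence, valid also when the limit is infinite. *)
Lemma joint_value_cvg M N (Z : Omega -> 'M[R]_(dx, 1 + n)) : measurable_fun setT Z ->
  (forall x, (fun k => qform (Mk k) x) @ \oo --> qform M x) ->
  (forall x, (fun k => qform (Nk k) x) @ \oo --> qform N x) ->
  (fun k => \int[Pr]_w (joint_form (Mk k) (Nk k) (Z w))%:E) @ \oo -->
  \int[Pr]_w (joint_form M N (Z w))%:E.
Proof.
move=> mZ cM cN.
have -> : \int[Pr]_w (joint_form M N (Z w))%:E =
    \int[Pr]_w limn (fun k => (joint_form (Mk k) (Nk k) (Z w))%:E).
  apply: eq_integral => w _; apply/esym/cvg_lim => //.
  apply/cvg_EFin; first exact: nearW.
  exact: joint_form_cvg.
apply: cvg_monotone_convergence => //.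
- by move=> k; exact/measurable_EFinP/measurable_joint_form.
- by move=> k w _; rewrite lee_fin joint_form_ge0//; exact: value_iter_psd.
- move=> w _ k l kl; rewrite lee_fin; apply: joint_form_le => x.
    exact: (value_iter_nondecreasing beta_gt0 _ _ QPH_psd R_pd x kl).
  exact: (value_iter_nondecreasing beta_gt0 _ _ Qbar_psd Rbar_pd x kl).
Qed.

Lemma linear_strategy_optimal M N :
  psd_riccati beta (mA m) (mB m) (mQ m + mP m + mH m)%R (mR m) M ->
  psd_riccati beta (Abar m) (Bbar m) (Qbar m) (Rbar m) N ->
  (forall x, (fun k => qform (Mk k) x) @ \oo --> qform M x) ->
  (forall x, (fun k => qform (Nk k) x) @ \oo --> qform N x) ->
  optimal Pr beta m X1 W (linear_strategy n
    (riccati_gain beta (mA m) (mB m) (mR m) M)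
    (riccati_gain beta (Abar m) (Bbar m) (Rbar m) N)).
Proof.
move=> [pM eM] [pN eN] cM cN; set g := linear_strategy _ _ _.
have admg : admissible g by exact: linear_strategy_admissible.
split=> [|h admh]; first exact: admg.
have bellman_eq t : expected_cost g t + beta%:E * state_value g M N t.+1 =
    state_value g M N t + beta%:E * noise_value M N t.
  rewrite cost_to_goE//; congr (_ + _); apply: eq_integral => w _; congr EFin.
  rewrite stage_cost_joint// -joint_riccatiE//.
  - by congr joint_form; rewrite -/(riccati_op _ _ _ _ _ _) -?eM -?eN.
  - by have [] := joint_action_linear n_gt0 (riccati_gain beta (mA m) (mB m) (mR m) M)
      (riccati_gain beta (Abar m) (Bbar m) (Rbar m) N) t (S g t w).
  - by have [] := joint_action_linear n_gt0 (riccati_gain beta (mA m) (mB m) (mR m) M)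
      (riccati_gain beta (Abar m) (Bbar m) (Rbar m) N) t (S g t w).
have w0 s : 0 <= noise_value M N s by exact: joint_value_ge0.
have v0 s : 0 <= state_value g M N s by exact: joint_value_ge0.
have dW0 K t : 0 <= beta%:E * discounted_sum beta (noise_value M N) K t.
  exact: mule_ge0 betaE_ge0 (discounted_sum_ge0 beta_ge0 K t w0).
(* The Bellman equality is iterated; the inequality comes only from discarding the terminal
   value. *)
have upper K t : discounted_sum beta (expected_cost g) K t <=
    state_value g M N t + beta%:E * discounted_sum beta (noise_value M N) K t.
  elim: K t => [|K IH] t; first by rewrite /= mule0 adde0 v0.
  apply: le_trans (leeD2l _ (lee_wpmul2l betaE_ge0 (IH t.+1))) _.
  rewrite (ge0_muleDr beta%:E (v0 t.+1) (dW0 K t.+1)) addeA bellman_eq.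
  by rewrite /= (ge0_muleDr beta%:E (w0 t) (dW0 K t.+1)) addeA.
have v0' : 0 <= state_value h M N 0 by exact: joint_value_ge0.
(* For fixed K, k tends to infinity in the value iteration bound; the cost over K + k stages never
   exceeds the total cost. *)
have lower K : state_value h M N 0 + beta%:E * discounted_sum beta (noise_value M N) K 0
    <= total_cost Pr beta m h X1 W.
  have cS : (fun k => state_value h (Mk k) (Nk k) 0) @ \oo --> state_value h M N 0.
    exact: joint_value_cvg.
  have cW : (fun k => discounted_sum beta (noise_value (Mk k) (Nk k)) K 0) @ \oo -->
      discounted_sum beta (noise_value M N) K 0.
    apply: (discounted_sum_cvg beta_ge0) => [k s|s].
      by apply: joint_value_ge0; exact: value_iter_psd.
    exact: joint_value_cvg.
  have cL : (fun k => state_value h (Mk k) (Nk k) 0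
      + beta%:E * discounted_sum beta (noise_value (Mk k) (Nk k)) K 0) @ \oo -->
      state_value h M N 0 + beta%:E * discounted_sum beta (noise_value M N) K 0.
    apply: cvgeD => //; last exact: cvgeZl.
    by apply: ge0_adde_def; rewrite inE; [exact: v0'|exact: dW0].
  apply: (cvge_to_le cL); apply: nearW => k.
  apply: le_trans (value_iter_lower_bound k K 0 admh) _.
  rewrite (total_costE admh) (discounted_sumE beta_ge0); last exact: expected_cost_ge0.
  apply: nneseries_lim_ge => t _ _.
  by rewrite mule_ge0 ?lee_fin ?exprn_ge0// expected_cost_ge0.
rewrite (total_costE admg); apply: lime_le.
  apply: is_cvg_nneseries => t _ _.
  by rewrite mule_ge0 ?lee_fin ?exprn_ge0// expected_cost_ge0.
(* At time 0 the state is [X1] under every strategy, so the upper bound for g and the lower bound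
   for h are the same expression. *)
apply: nearW => K; apply: le_trans (lower K).
by have := upper K 0%N; rewrite discounted_sumE//; exact: expected_cost_ge0.
Qed.

End optimality.

Theorem theorem2 (R : realType) (n dx du : nat)
    (n_gt0 : (0 < n)%N) (dx_gt0 : (0 < dx)%N) (du_gt0 : (0 < du)%N)
    (beta : R) (beta_gt0 : 0 < beta) (beta_le1 : beta <= 1)
    (m : lf_model R dx du)
    (Q0_sym : (mQ0 m)^T = mQ0 m) (R0_sym : (mR0 m)^T = mR0 m)
    (Q_sym : (mQ m)^T = mQ m) (P_sym : (mP m)^T = mP m)
    (R_sym : (mR m)^T = mR m) (H_sym : (mH m)^T = mH m)
    (d : measure_display) (Omega : measurableType d)
    (Pr : probability Omega R)
    (X1 : Omega -> 'M[R]_(dx, 1 + n)) (W : nat -> Omega -> 'M[R]_(dx, 1 + n))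
    (X1_meas : measurable_fun setT X1)
    (W_meas : forall t, measurable_fun setT (W t))
    (W_mean : forall t, zero_mean Pr (W t))
    (indep : independent_in_time Pr X1 W)
    (QPH_psd : psd (mQ m + mP m + mH m)) (Qbar_psd : psd (Qbar m))
    (R0_pd : pd (mR0 m)) (R_pd : pd (mR m))
    (stab : stabilizable (Num.sqrt beta *: mA m) (Num.sqrt beta *: mB m))
    (stab_bar :
       stabilizable (Num.sqrt beta *: Abar m) (Num.sqrt beta *: Bbar m))
    (det : detectable (Num.sqrt beta *: mA m) (sqrtmx (mQ m)))
    (det_bar : detectable (Num.sqrt beta *: Abar m) (sqrtmx (Qbar m))) :
  (exists Mb : 'M[R]_dx,
     least_psd_riccati beta (mA m) (mB m) (mQ m + mP m + mH m) (mR m) Mb) /\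
  (exists Mbar : 'M[R]_(dx + dx),
     psd_riccati beta (Abar m) (Bbar m) (Qbar m) (Rbar m) Mbar) /\
  (forall (Mb : 'M[R]_dx) (Mbar : 'M[R]_(dx + dx)),
     least_psd_riccati beta (mA m) (mB m) (mQ m + mP m + mH m) (mR m) Mb ->
     psd_riccati beta (Abar m) (Bbar m) (Qbar m) (Rbar m) Mbar ->
     optimal Pr beta m X1 W
       (linear_strategy n
          (riccati_gain beta (mA m) (mB m) (mR m) Mb)
          (riccati_gain beta (Abar m) (Bbar m) (Rbar m) Mbar))).

Proof.
have Rbar_pd : pd (Rbar m) by exact: block_diag_pd.
split.
  have [Mb leastMb _] := exists_least_psd_riccati beta_gt0 QPH_psd R_pd stab.
  by exists Mb.
split.
  have [Mbar [solMbar _] _] :=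
    exists_least_psd_riccati beta_gt0 Qbar_psd Rbar_pd stab_bar.
  by exists Mbar.
(* Value iteration reaches [Mb] because [Mb] is least, and [Mbar] because detectability makes it the
   only solution. *)
move=> Mb Mbar leastMb solMbar; apply: linear_strategy_optimal => //.
- exact: leastMb.1.
- exact: value_iter_cvg_least.
- exact: value_iter_cvg_detectable.
Qed.
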